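(* Work in the robust nonparametric regression model described in the context, suppose Assumptions (P1)–(P4), (K1)–(K3), (H1)–(H3) hold, and suppose moreover that $K(\mathbf{u})$ is monotonically decreasing in $\|\mathbf{u}\|$. Then $$\mathbb{E}\left[\sup_{\mathcal{A}}\sup_{\mathbf{x}}|\hat{\eta}_0(\mathbf{x})-\eta(\mathbf{x})|\right] \lesssim \frac{Tq}{Nh^d} + h + \frac{\ln N}{\sqrt{Nh^d}},$$ where the expectation is over the training samples and $\sup_{\mathcal{A}}$ is the supremum over all attack strategies.
   Context: Model. Fix a norm $\|\cdot\|$ on $\mathbb{R}^d$; $v_d$ is the volume of its unit ball and $B(\mathbf{x},r)$ the ball of radius $r$ about $\mathbf{x}$. Training inputs $\mathbf{X}_1,\dots,\mathbf{X}_N\in\mathbb{R}^d$ are i.i.d. with probability density $f$. Noise variables $W_1,\dots,W_N$ are independent with zero mean and finite variance. There is a set $\mathcal{B}\subset\{1,\dots,N\}$ of attacked indices with $|\mathcal{B}|\le q$; the observed labels are $Y_i=\eta(\mathbf{X}_i)+W_i$ for $i\notin\mathcal{B}$, while for $i\in\mathcal{B}$, $Y_i$ is an arbitrary real value chosen by an adversary. The adversary (white-box) knows $\eta$, all $\mathbf{X}_i$ and $W_i$, and the estimation algorithm; an attack strategy $\mathcal{A}$ is a choice of $\mathcal{B}$ and corrupted values, and $\sup_{\mathcal{A}}$ denotes supremum over all of them. Estimator. With kernel $K$, bandwidth $h>0$, threshold $T>0$ and bound $M>0$, $$\hat\eta_0(\mathbf{x})=\arg\min_{|s|\le M}\sum_{i=1}^N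 K\!\left(\frac{\mathbf{x}-\mathbf{X}_i}{h}\right)\phi(Y_i-s),$$ ties broken arbitrarily, where $\phi(u)=u^2$ if $|u|\le T$ and $\phi(u)=2T|u|-T^2$ if $|u|>T$. Problem Assumptions: there are a compact set $\mathcal{X}$ and constants $L,\gamma,f_m,f_M,D,\alpha,\sigma>0$ such that $f$ is supported on $\mathcal{X}$ and (P1) $|\eta(\mathbf{x}_1)-\eta(\mathbf{x}_2)|\le L\|\mathbf{x}_1-\mathbf{x}_2\|$ for $\mathbf{x}_1,\mathbf{x}_2\in\mathcal{X}$; (P2) $f_m\le f(\mathbf{x})\le f_M$ and $|\eta(\mathbf{x})|\le M$ for $\mathbf{x}\in\mathcal{X}$; (P3) $\mathrm{Vol}(B(\mathbf{x},r)\cap\mathcal{X})\ge\alpha v_d r^d$ for all $r<D$, $\mathbf{x}\in\mathcal{X}$; (P4) $\mathbb{E}[e^{\lambda W_i}]\le e^{\sigma^2\lambda^2/2}$ for all $|\lambda|\le1/\sigma$. Kernel Assumptions: (K1) $\int K=1$; (K2) $K(\mathbf{u})=0$ for $\|\mathbf{u}\|>1$; (K3) $c_K\le K(\mathbf{u})\le C_K$ (for $\|\mathbf u\|\le1$) for constants $0<c_K\le C_K$. Parameter Assumptions: (H1) $h>\ln^2N/N$; (H2) $T\ge 4Lh+16\sigma\ln N$; (H3) $M>\sup_{\mathbf{x}\in\mathcal{X}}|\eta(\mathbf{x})|$. Notation: $a\lesssim b$ means $a\le Cb$ for a constant $C$ depending only on $L,M,\gamma,f_m,f_M,D,\alpha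,\sigma,c_K,C_K$.
   Formalization: The formal theorem assumes N ≥ 2: for N = 1 we have ln N = 0 and the stated bound fails for small h. The supremum over x runs over the support set, and the expectation is an outer expectation via a measurable majorant. *)

(* Defs.v *)
From HB Require Import structures.
From mathcomp Require Import all_boot all_order all_algebra.
From mathcomp Require Import all_classical all_reals all_analysis measurable_realfun.
Set Implicit Arguments. Unset Strict Implicit. Unset Printing Implicit Defensive.
Import Order.TTheory GRing.Theory Num.Theory.
Import numFieldNormedType.Exports.
Local Open Scope classical_set_scope.
Local Open Scope ring_scope.

(* Points of R^d are d-tuples of reals; d.-tuple R carries the product
   (= Borel) sigma-algebra from MathComp-Analysis. *)

Definition tadd (R : realType) d (x y : d.-tuple R) : d.-tuple R :=
  mktuple (fun i => tnth x i + tnth y i).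
Definition tsub (R : realType) d (x y : d.-tuple R) : d.-tuple R :=
  mktuple (fun i => tnth x i - tnth y i).
Definition tscale (R : realType) d (c : R) (x : d.-tuple R) : d.-tuple R :=
  mktuple (fun i => c * tnth x i).
Definition tzero (R : realType) d : d.-tuple R := mktuple (fun _ => 0).

Definition is_norm (R : realType) d (nrm : d.-tuple R -> R) : Prop :=
  [/\ forall x, 0 <= nrm x,
      forall x, nrm x = 0 -> x = tzero R d,
      forall c x, nrm (tscale c x) = `|c| * nrm x &
      forall x y, nrm (tadd x y) <= nrm x + nrm y].

Definition nball (R : realType) d (nrm : d.-tuple R -> R) (x : d.-tuple R) (r : R)
  : set (d.-tuple R) := [set y | nrm (tsub y x) <= r].

(* lam is Lebesgue measure on (the Borel sets of) R^d: it gives every box its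
   volume; this determines it uniquely on the product sigma-algebra. *)
Definition is_lebesgue (R : realType) d
    (lam : {measure set (d.-tuple R) -> \bar R}) : Prop :=
  forall a b : d.-tuple R, (forall i, tnth a i <= tnth b i) ->
    lam [set x | forall i, tnth a i <= tnth x i <= tnth b i] =
    (\prod_(i < d) (tnth b i - tnth a i))%:E.

Definition vol_unit_ball (R : realType) d (nrm : d.-tuple R -> R)
    (lam : {measure set (d.-tuple R) -> \bar R}) : R :=
  fine (lam (nball nrm (tzero R d) 1)).

(* identification of d-tuples with row vectors, to use the library topology *)
Definition row_of_tuple (R : realType) d (x : d.-tuple R) : 'rV[R]_d :=
  \row_i tnth x i.

Definition has_density (R : realType) d (d0 : measure_display)
    (Omega : measurableType d0) (P : probability Omega R)
    (lam : {measure set (d.-tuple R) -> \bar R})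
    (X : Omega -> d.-tuple R) (f : d.-tuple R -> R) : Prop :=
  forall A : set (d.-tuple R), measurable A ->
    P (X @^-1` A) = (\int[lam]_(x in A) (f x)%:E)%E.

(* mutual independence of the 2N random variables X_1..X_N, W_1..W_N
   (product rule for all events; taking some sets = setT gives every
   subfamily) *)
Definition mutually_independent (R : realType) d (d0 : measure_display)
    (Omega : measurableType d0) (P : probability Omega R) (N : nat)
    (X : 'I_N -> Omega -> d.-tuple R) (W : 'I_N -> Omega -> R) : Prop :=
  forall (A : 'I_N -> set (d.-tuple R)) (B : 'I_N -> set R),
    (forall i, measurable (A i)) -> (forall i, measurable (B i)) ->
    P (\bigcap_i (X i @^-1` A i `&` W i @^-1` B i)) =
    (\prod_(i < N) (fine (P (X i @^-1` A i)) * fine (P (W i @^-1` B i))))%:E.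

Definition huber (R : realType) (T u : R) : R :=
  if `|u| <= T then u ^+ 2 else 2 * T * `|u| - T ^+ 2.

Definition huber_objective (R : realType) d (N : nat) (K : d.-tuple R -> R)
    (h T : R) (Xs : 'I_N -> d.-tuple R) (Ys : 'I_N -> R) (x : d.-tuple R) (s : R)
    : R :=
  \sum_(i < N) K (tscale h^-1 (tsub x (Xs i))) * huber T (Ys i - s).

(* s is a possible value of hat eta_0(x) (a minimiser over |s| <= M;
   ties are broken arbitrarily, so every minimiser is allowed) *)
Definition is_eta0_hat (R : realType) d (N : nat) (K : d.-tuple R -> R)
    (h T M : R) (Xs : 'I_N -> d.-tuple R) (Ys : 'I_N -> R) (x : d.-tuple R) (s : R)
    : Prop :=
  `|s| <= M /\
  forall s', `|s'| <= M ->
    huber_objective K h T Xs Ys x s <= huber_objective K h T Xs Ys x s'.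

Definition attacked_labels (R : realType) d (N q : nat) (eta : d.-tuple R -> R)
    (Xs : 'I_N -> d.-tuple R) (Ws : 'I_N -> R) (Ys : 'I_N -> R) : Prop :=
  exists Bad : {set 'I_N}, (#|Bad| <= q)%N /\
    forall i, i \notin Bad -> Ys i = eta (Xs i) + Ws i.

Definition worst_error (R : realType) d (N q : nat) (K : d.-tuple R -> R)
    (h T M : R) (Xset : set (d.-tuple R)) (eta : d.-tuple R -> R)
    (Xs : 'I_N -> d.-tuple R) (Ws : 'I_N -> R) : \bar R :=
  ereal_sup [set e : \bar R | exists (x : d.-tuple R) (Ys : 'I_N -> R) (s : R),
    [/\ Xset x, attacked_labels q eta Xs Ws Ys,
        is_eta0_hat K h T M Xs Ys x s & e = (`|s - eta x|)%:E]].

(* Main.v *)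
(** Fix a sample and compare the minimiser [s] at [x] with a point [s'] strictly
between [eta x] and [s], at distance at most [T / 4] from [eta x]. Convexity of the Huber loss
bounds the slope of the objective at [s'] in the direction of [s]: each attacked
label contributes at most [2 * T * CK], while every other label lies in the
quadratic zone and contributes [2 * K_i * (W_i + eta (X_i) - s')]. Hence
[|s - eta x|] is bounded by [h], plus [T * q], plus the weighted noise sum
[|\sum_i K_i * W_i|], the last two divided by the number of sample points in the
ball of radius [h] about [x].

Since [K] decreases with the norm, the weighted noise sum at [x] is at most [CK]
times the largest [|\sum_(X_i in B) W_i|] over balls [B] about [x] of radius at
most [h]. Balls of an arbitrary norm can have infinite VC dimension, so instead of
counting the sets that they cut out of the sample, centres and radii are discretised
at scale [h / N]. A packing argument bounds the net polynomially in [N], and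
the discretisation error is the number of sample points in annuli of width
[3 * h / N], each of which contains [O(ln N)] points with high probability.
Chernoff bounds and a union bound make the exceptional event of probability
[O(1 / N) = O(h)], and on it the error is at most [2 * M]. When [h >= D],
[N * h ^ d] is below a multiple of [ln N ^ 2], or [q] is above a multiple of
[N * h ^ d], the trivial bound [2 * M] is already of the required order. *)

Require Import Defs.
From HB Require Import structures.
From mathcomp Require Import all_boot all_order all_algebra.
From mathcomp Require Import all_classical all_reals all_analysis measurable_realfun.
From mathcomp Require Import ring lra.
Set Implicit Arguments.
Unset Strict Implicit.
Unset Printing Implicit Defensive.
Import Order.TTheory GRing.Theory Num.Theory.
Import numFieldNormedType.Exports.
Local Open Scope classical_set_scope.
Local Open Scope ring_scope.

(** * Huber minimisers *)

(** The derivative of the Huber loss: [2 * u] clipped to the range from [- 2 * T] to [2 * T]. *)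
Definition huber_slope (R : realType) (T u : R) : R :=
  2 * Num.max (- T) (Num.min u T).

(** Convexity of the Huber loss in the form of a supporting line. The cases locate [u] relative to
    [- T] and [T]; the fourth is contradictory. *)
Lemma huber_subgradient (R : realType) (T u v : R) : 0 < T ->
  huber T u + huber_slope T u * (v - u) <= huber T v.
Proof.
move=> T0; rewrite /huber /huber_slope.
have sq : 0 <= (v - u) ^+ 2 by rewrite sqr_ge0.
case: (lerP u T) => uT; case: (lerP (- T) u) => Tu.
- have -> : `|u| <= T by rewrite ler_norml Tu uT.
  case: ifPn; first nra.
  rewrite -ltNge; case: (ger0P v) => v0 Tv; nra.
- have u0 : u < 0 by lra.
  have -> : (`|u| <= T) = false by rewrite ler_norml leNgt Tu.
  rewrite (ltr0_norm u0).
  case: ifPn => [|_]; first by rewrite ler_norml => /andP[? ?]; nra.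
  have := ler_norm (- v); rewrite normrN; nra.
- have -> : (`|u| <= T) = false by apply/negbTE; rewrite -ltNge (lt_le_trans uT) ?ler_norm.
  have u0 : 0 < u by lra.
  rewrite (gtr0_norm u0) max_r; last lra.
  case: ifPn => [|_]; first by rewrite ler_norml => /andP[? ?]; nra.
  have := ler_norm v; nra.
- lra.
Qed.

Lemma huber_slope_le (R : realType) (T u : R) : 0 < T ->
  huber_slope T u <= 2 * T.
Proof.
by move=> T0; rewrite /huber_slope ler_pM2l // ge_max ge_min lexx orbT andbT; lra.
Qed.

Lemma huber_slopeE (R : realType) (T u : R) : - T <= u <= T ->
  huber_slope T u = 2 * u.
Proof. by move=> /andP[? ?]; rewrite /huber_slope min_l // max_r. Qed.

Lemma huberN (R : realType) (T u : R) : huber T (- u) = huber T u.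
Proof. by rewrite /huber normrN sqrrN. Qed.

(* Peeling off the smallest positive weight [m] on the whole support, which is a
   ball, leaves weights of the same shape with a smaller support. *)
Lemma radial_weighted_sum (R : realType) (I : finType) (r k w : I -> R) (b c : R) :
  (forall i, 0 <= k i <= c) ->
  (forall i j, r i <= r j -> k j <= k i) ->
  0 <= b -> 0 <= c ->
  (forall j, k j != 0 -> `|\sum_(i | r i <= r j) w i| <= b) ->
  `|\sum_i k i * w i| <= c * b.
Proof.
have [n] := ubnP #|[set i | k i != 0]%SET|.
elim: n k c => // n IH k c kn k0 kr b0 c0 kb.
have [S0|[i0 i0S]] := set_0Vmem [set i | k i != 0]%SET.
  rewrite big1 ?normr0 ?mulr_ge0 // => i _.
  by move: S0 => /setP/(_ i); rewrite !inE => /negbFE/eqP ->; rewrite mul0r.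
have [j jS jmin] := @arg_minP _ _ _ i0 (fun i => i \in [set i | k i != 0]%SET) k i0S.
set m := k j in jmin *.
have kj0 : k j != 0 by move: jS; rewrite inE.
have m0 : 0 < m by rewrite lt_neqAle eq_sym kj0; case/andP: (k0 j).
have [l lS lmax] := @arg_maxP _ _ _ i0 (fun i => i \in [set i | k i != 0]%SET) r i0S.
have kl0 : k l != 0 by move: lS; rewrite inE.
(* Since weights do not increase with [r], their support is exactly the ball whose radius is the
   largest [r] on the support. *)
have suppE i : (k i != 0) = (r i <= r l).
  apply/idP/idP => [ki|il]; first by apply: lmax; rewrite inE.
  rewrite gt_eqF //; apply: lt_le_trans (kr _ _ il).
  by rewrite lt_neqAle eq_sym kl0; case/andP: (k0 l).
pose k' i := k i - (if k i != 0 then m else 0).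
have km i : k i != 0 -> m <= k i by move=> ki; apply: jmin; rewrite inE.
have mc : m <= c by case/andP: (k0 j).
have k'0 i : k' i != 0 -> k i != 0.
  by apply: contra => /eqP ki; rewrite /k' ki eqxx subr0.
(* The peeled layer has constant weight [m] on that ball. The rest, [k'], is at most [c - m] and
   vanishes at [j], so the induction hypothesis bounds its sum by [(c - m) * b]. *)
have -> : \sum_i k i * w i = m * (\sum_(i | r i <= r l) w i) + \sum_i k' i * w i.
  rewrite mulr_sumr [X in _ = X + _]big_mkcond /= -big_split /=; apply: eq_bigr => i _.
  rewrite -suppE /k'; case: ifP => _; lra.
have -> : c * b = m * b + (c - m) * b by ring.
apply: le_trans (ler_normD _ _) _; apply: lerD.
  by rewrite normrM gtr0_norm // ler_pM2l //; apply: kb.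
apply: IH => //.
- rewrite -ltnS; apply: leq_trans kn; rewrite ltnS; apply: proper_card; apply/properP; split.
    by apply/fintype.subsetP => i; rewrite !inE; exact: k'0.
  by exists j; rewrite !inE // /k' kj0 subrr eqxx.
- move=> i; rewrite /k'; case: ifPn => [ki|/negbNE/eqP ->].
    by have := km _ ki; have /andP[] := k0 i; lra.
  by rewrite subrr lexx subr_ge0.
- move=> i i' ii'; have kk := kr _ _ ii'; rewrite /k'.
  have /andP[ki0 _] := k0 i; have /andP[ki'0 _] := k0 i'.
  case: ifPn => [ki'|/negbNE/eqP ->]; last first.
    by rewrite subrr; case: ifPn => [ki|_]; rewrite ?subr0 // subr_ge0 km.
  by rewrite ifT ?lerD2r // suppE (le_trans ii') // -suppE.
- by rewrite subr_ge0.
- by move=> i /k'0; exact: kb.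
Qed.

Lemma huber_minimizer_upper (R : realType) (I : finType) (bad : {set I})
    (k y w : I -> R) (T M s e0 b0 c tau : R) (q : nat) :
  0 < T -> 0 <= c -> (forall i, 0 <= k i <= c) ->
  `|s| <= M -> `|e0| <= M -> e0 + tau < s -> 0 <= tau -> tau <= T / 4 ->
  (forall s', `|s'| <= M ->
     \sum_i k i * huber T (y i - s) <= \sum_i k i * huber T (y i - s')) ->
  (#|bad| <= q)%N ->
  0 <= b0 ->
  (forall i, i \notin bad -> k i != 0 -> `|y i - w i - e0| <= b0) ->
  (forall i, k i != 0 -> b0 + `|w i| <= T / 2) ->
  tau * (\sum_(i | i \notin bad) k i) <=
    b0 * (\sum_(i | i \notin bad) k i) + `|\sum_i k i * w i| + 2 * c * T * q%:R.
Proof.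
move=> T0 c0 k0 sM eM es tau0 tauT smin badq b00 yw wa0.
(* The sum is minus the derivative of the objective at [e0 + tau]. Convexity forces its sign,
   because the minimiser [s] lies beyond that point. *)
have slope0 : 0 <= \sum_i k i * huber_slope T (y i - (e0 + tau)).
  have s'M : `|e0 + tau| <= M.
    move: sM eM; rewrite !ler_norml => /andP[? ?] /andP[? ?]; apply/andP; split; lra.
  have := smin _ s'M.
  have : \sum_i (k i * huber T (y i - (e0 + tau)) +
      (k i * huber_slope T (y i - (e0 + tau))) * ((e0 + tau) - s)) <=
      \sum_i k i * huber T (y i - s).
    apply: ler_sum => i _; have /andP[ki0 _] := k0 i.
    have := huber_subgradient (y i - (e0 + tau)) (y i - s) T0.
    move=> /(ler_wpM2l ki0); rewrite mulrDr mulrA.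
    by have -> : y i - s - (y i - (e0 + tau)) = e0 + tau - s by ring.
  rewrite big_split /= -mulr_suml => h1 h2.
  have h3 : (\sum_i k i * huber_slope T (y i - (e0 + tau))) * ((e0 + tau) - s) <= 0 by lra.
  move: h3; rewrite nmulr_lle0 //; lra.
have badS (u : R) (F : I -> R) : 0 <= u -> (forall i, F i <= c * u) ->
    \sum_(i in bad) F i <= c * u * q%:R.
  move=> u0 Fu; apply: (@le_trans _ _ (\sum_(i in bad) c * u)).
    exact: ler_sum.
  rewrite sumr_const -[_ *+ _]mulr_natr; apply: ler_wpM2l; first exact: mulr_ge0.
  by rewrite ler_nat.
have good i : i \notin bad ->
    k i * huber_slope T (y i - (e0 + tau)) <= k i * (2 * (w i + b0 - tau)).
  move=> ib; have [->|ki] := eqVneq (k i) 0; first by rewrite !mul0r.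
  have /andP[ki0 _] := k0 i; apply: ler_wpM2l => //.
  have := yw i ib ki; have := wa0 i ki.
  rewrite ler_norml => h1 /andP[h2 h3].
  have := ler_norm (w i); have := ler_norm (- w i); rewrite normrN => h4 h5.
  (* The residual stays in the quadratic zone: bias and noise contribute at most [T / 2], and [tau]
     at most [T / 4]. *)
  rewrite huber_slopeE; first lra.
  by apply/andP; split; lra.
have h1 : 0 <= c * (2 * T) * q%:R + \sum_(i | i \notin bad) k i * (2 * (w i + b0 - tau)).
  apply: le_trans slope0 _; rewrite (bigID (mem bad)) /=; apply: lerD.
    apply: badS => [|i]; first lra.
    have /andP[? ?] := k0 i.
    apply: (le_trans (ler_wpM2l _ (huber_slope_le _ T0))) => //.
    by apply: ler_wpM2r => //; lra.
  by apply: ler_sum => i ib; exact: good.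
(* The noise of the attacked indices is put back, at a cost of at most [c * T / 2] each. The
   resulting full sum no longer depends on which indices the adversary chose. *)
have h2 : \sum_(i | i \notin bad) k i * w i <= `|\sum_i k i * w i| + c * (T/2) * q%:R.
  have -> : \sum_(i | i \notin bad) k i * w i = \sum_i k i * w i + \sum_(i in bad) - (k i * w i).
    rewrite [X in _ = X + _](bigID (mem bad)) /= sumrN; ring.
  apply: lerD; first exact: ler_norm.
  apply: badS => [|i]; first lra.
  have /andP[ki0 kc] := k0 i.
  have [->|ki] := eqVneq (k i) 0.
    by rewrite mul0r oppr0 mulr_ge0 //; lra.
  rewrite -mulrN; apply: (@le_trans _ _ (k i * (T / 2))).
    apply: ler_wpM2l => //; apply: le_trans (ler_norm _) _.
    by rewrite normrN; have := wa0 i ki; lra.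
  by apply: ler_wpM2r => //; lra.
have e1 : \sum_(i | i \notin bad) k i * (2 * (w i + b0 - tau)) =
    2 * (\sum_(i | i \notin bad) k i * w i) +
    2 * (b0 - tau) * (\sum_(i | i \notin bad) k i).
  by rewrite !mulr_sumr -big_split /=; apply: eq_bigr => i _; ring.
have cTq : 0 <= c * T * q%:R by rewrite !mulr_ge0 // ltW.
rewrite e1 in h1; set Sk := \sum_(i | _) k i in h1 *.
have e2 : c * (2 * T) * q%:R = 2 * (c * T * q%:R) by ring.
have e3 : c * (T / 2) * q%:R = c * T * q%:R / 2 by field.
have e4 : 2 * c * T * q%:R = 2 * (c * T * q%:R) by ring.
have e5 : 2 * (b0 - tau) * Sk = 2 * (b0 * Sk) - 2 * (tau * Sk) by ring.
lra.
Qed.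

(** The loss is even, so the case [s < e0] follows from the other one by negating labels, noise, [s]
    and [e0]. *)
Lemma huber_minimizer_error (R : realType) (I : finType) (bad : {set I})
    (k y w : I -> R) (T M s e0 b0 c tau : R) (q : nat) :
  0 < T -> 0 <= c -> (forall i, 0 <= k i <= c) ->
  `|s| <= M -> `|e0| <= M -> tau < `|s - e0| -> 0 <= tau -> tau <= T / 4 ->
  (forall s', `|s'| <= M ->
     \sum_i k i * huber T (y i - s) <= \sum_i k i * huber T (y i - s')) ->
  (#|bad| <= q)%N -> 0 <= b0 ->
  (forall i, i \notin bad -> k i != 0 -> `|y i - w i - e0| <= b0) ->
  (forall i, k i != 0 -> b0 + `|w i| <= T / 2) ->
  tau * (\sum_(i | i \notin bad) k i) <=
    b0 * (\sum_(i | i \notin bad) k i) + `|\sum_i k i * w i| + 2 * c * T * q%:R.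
Proof.
move=> T0 c0 k0 sM eM es tau0 tauT smin badq b00 yw wa.
have [es0|es0] := lerP e0 s.
  apply: (@huber_minimizer_upper _ _ _ k y w T M s e0 b0) => //.
  by move: es; rewrite ger0_norm ?subr_ge0 //; lra.
have nE : `|\sum_i k i * w i| = `|\sum_i k i * (- w i)|.
  rewrite -normrN -sumrN; congr (`| _ |).
  by apply: eq_bigr => i _; rewrite mulrN.
rewrite nE.
apply: (@huber_minimizer_upper _ _ _ k (fun i => - y i) (fun i => - w i) T M (- s) (- e0)) => //.
- by rewrite normrN.
- by rewrite normrN.
- by move: es; rewrite ltr0_norm ?subr_lt0 //; lra.
- move=> s' s'M; have := smin (- s'); rewrite normrN => /(_ s'M).
  rewrite [in X in X -> _](eq_bigr (fun i => k i * huber T (- y i - - s))).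
    rewrite [in X in _ <= X -> _](eq_bigr (fun i => k i * huber T (- y i - s'))) //.
    by move=> i _; rewrite -huberN; congr (_ * huber _ _); ring.
  by move=> i _; rewrite -huberN; congr (_ * huber _ _); ring.
- move=> i ib ki; have := yw i ib ki; rewrite -normrN; congr (`| _ | <= _); ring.
- by move=> i ki; rewrite normrN; exact: wa.
Qed.

(** * Norms and Lebesgue measure on tuples *)

Definition tbox (R : realType) d (a b : d.-tuple R) : set (d.-tuple R) :=
  [set x | forall i, tnth a i <= tnth x i <= tnth b i].

Lemma measurable_tbox (R : realType) d (a b : d.-tuple R) :
  measurable (tbox a b).
Proof.
have -> : tbox a b =
    \bigcap_(i : 'I_d) ((fun x : d.-tuple R => tnth x i) @^-1` `[tnth a i, tnth b i]).
  apply/seteqP; split=> x /= xab i.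
    by move=> _ /=; rewrite in_itv /=; exact: xab.
  by have := xab i Logic.I; rewrite /= in_itv.
apply: fin_bigcap_measurable => // i _.
rewrite -[X in measurable X]setTI.
exact: (measurable_tnth i measurableT).
Qed.

(** Prepares the uniqueness argument for Lebesgue measure, whose values are prescribed on boxes
    only. A coordinate half-space is a union of growing boxes whose lower side in that coordinate
    stays fixed. *)
Lemma tuple_measurableE (R : realType) d :
  @measurable _ (d.-tuple R) = <<s range (fun ab => @tbox R d ab.1 ab.2) >>.
Proof.
set G := range _.
apply/seteqP; split; last first.
  apply: smallest_sub; first exact: sigma_algebra_measurable.
  by move=> _ [[a b] _ <-]; exact: measurable_tbox.
have mid : measurable_fun [set: g_sigma_algebraType G] (id : _ -> d.-tuple R).
  apply/measurable_fun_tnthP => i.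
  apply: (measurability _ (RGenCInfty.measurableE R)) => _ [_ [r ->] <-].
  rewrite setTI.
  pose lo n := mktuple (fun j : 'I_d => if j == i then r else - (n%:R : R)).
  pose hi n := mktuple (fun j : 'I_d => (n%:R : R)).
  suff -> : ((tnth (T:=R))^~ i \o id) @^-1` `[r, +oo[ = \bigcup_n tbox (lo n) (hi n).
    by apply: bigcupT_measurable => n; apply: sub_sigma_algebra; exists (lo n, hi n).
  apply/seteqP; split => [x /= | x [n _ /= xn]]; last first.
    by have := xn i; rewrite !tnth_mktuple eqxx in_itv /= andbT => /andP[].
  rewrite in_itv /= andbT => rx.
  pose B : R := \sum_j `|tnth x j|.
  exists (Num.trunc B).+1 => //= j.
  have xB : `|tnth x j| <= (Num.trunc B).+1%:R.
    apply: le_trans (ltW (truncnS_gt B)).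
    by rewrite /B (bigD1 j) //= lerDl sumr_ge0.
  rewrite !tnth_mktuple; move: xB; rewrite ler_norml => /andP[xl ->].
  by rewrite andbT; case: eqVneq => // ->.
by move=> A mA; have := mid measurableT A mA; rewrite setTI.
Qed.

(** A set open for the sup distance is the union of the boxes with rational corners that it
    contains, and these are countably many. *)
Lemma measurable_tuple_open (R : realType) d (U : set (d.-tuple R)) :
  (forall x, U x -> exists2 e, 0 < e &
    forall y, (forall i, `|tnth y i - tnth x i| < e) -> U y) ->
  measurable U.
Proof.
move=> Uo.
pose rt (a : d.-tuple rat) : d.-tuple R := map_tuple (@ratr R) a.
pose F (ab : d.-tuple rat * d.-tuple rat) :=
  if `[< tbox (rt ab.1) (rt ab.2) `<=` U >] then tbox (rt ab.1) (rt ab.2) else set0.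
have -> : U = \bigcup_ab F ab.
  apply/seteqP; split => [x Ux|x [ab _]]; last first.
    by rewrite /F; case: asboolP => // abU; exact: abU.
  have [e e0 eU] := Uo x Ux.
  have lo i : exists q : rat, ratr q \in `](tnth x i - e), (tnth x i)[.
    by apply: rat_in_itvoo; rewrite gtrBl.
  have hi i : exists q : rat, ratr q \in `](tnth x i), (tnth x i + e)[.
    by apply: rat_in_itvoo; rewrite ltrDl.
  have {lo}[a alo] := fin_all_exists lo; have {hi}[b bhi] := fin_all_exists hi.
  exists (mktuple a, mktuple b) => //=.
  rewrite /F; case: asboolP => [_ i /=|[] y /= yab].
    rewrite !tnth_map !tnth_ord_tuple.
    by have := alo i; have := bhi i; rewrite !in_itv /= => /andP[? _] /andP[_ ?]; lra.
  apply: eU => i; have := yab i; rewrite !tnth_map !tnth_ord_tuple => /andP[].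
  have := alo i; have := bhi i; rewrite !in_itv /= ltr_norml => /andP[? ?] /andP[? ?] ? ?.
  by apply/andP; split; lra.
apply: countable_bigcupT_measurable; first exact: countableP.
by move=> ab; rewrite /F; case: ifP => _; [exact: measurable_tbox|exact: measurable0].
Qed.

(** Supplies measurability of the support of the density, whose compactness is expressed through row
    vectors. *)
Lemma tuple_of_row_compact_measurable (R : realType) d (S : set (d.-tuple R)) :
  compact (@row_of_tuple R d @` S) -> measurable S.
Proof.
move=> cS; rewrite -[S]setCK; apply: measurableC.
apply: measurable_tuple_open => x Sx.
have /closed_openC : closed (@row_of_tuple R d @` S).
  by apply: compact_closed => //; exact: norm_hausdorff.
rewrite openE => /(_ (row_of_tuple x)) Sn.
have /Sn/nbhs_ballP[e /= e0 eS] : (~` (@row_of_tuple R d @` S)) (row_of_tuple x).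
  move=> [y Sy yx]; apply: Sx; suff -> : x = y by [].
  by apply/eq_from_tnth => i; have /rowP/(_ i) := yx; rewrite !mxE.
exists e => // y yx Sy; apply: (eS (row_of_tuple y)); last by exists y.
by split => // i j; rewrite /ball /= !mxE distrC; exact: yx.
Qed.

(** One half of the equivalence with the sup norm, from the expansion in unit vectors and the
    triangle inequality; [coord_norm_bound] is the other half. *)
Lemma norm_coord_bound (R : realType) d (nrm : d.-tuple R -> R) : is_norm nrm ->
  exists2 c, 0 < c & forall (x : d.-tuple R) e, 0 <= e ->
    (forall i, `|tnth x i| <= e) -> nrm x <= c * e.
Proof.
move=> [n0 _ nZ nD].
pose unit i : d.-tuple R := mktuple (fun j => (j == i)%:R).
have nz : nrm (tzero R d) = 0.
  have -> : tzero R d = tscale 0 (tzero R d).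
    by apply/eq_from_tnth => i; rewrite !tnth_mktuple mul0r.
  by rewrite nZ normr0 mul0r.
pose part (x : d.-tuple R) (r : seq 'I_d) : d.-tuple R :=
  mktuple (fun j => \sum_(i <- r) tnth x i * (j == i)%:R).
have partn x r : nrm (part x r) <= \sum_(i <- r) `|tnth x i| * nrm (unit i).
  elim: r => [|i r IH].
    rewrite big_nil; suff -> : part x [::] = tzero R d by rewrite nz.
    by apply/eq_from_tnth => j; rewrite !tnth_mktuple big_nil.
  have -> : part x (i :: r) = tadd (tscale (tnth x i) (unit i)) (part x r).
    by apply/eq_from_tnth => j; rewrite !tnth_mktuple big_cons.
  by rewrite big_cons; apply: le_trans (nD _ _) _; rewrite nZ lerD2l.
have partx x : part x (index_enum 'I_d) = x.
  apply/eq_from_tnth => j; rewrite tnth_mktuple (bigD1 j) //= eqxx mulr1.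
  by rewrite big1 ?addr0 // => i ij; rewrite eq_sym (negbTE ij) mulr0.
exists (1 + \sum_i nrm (unit i)).
  by rewrite ltr_pwDl ?ltr01 ?sumr_ge0.
move=> x e e0 xe; rewrite -{1}[x]partx; apply: le_trans (partn _ _) _.
apply: (@le_trans _ _ (\sum_i e * nrm (unit i))).
  by apply: ler_sum => i _; apply: ler_wpM2r.
by rewrite -mulr_sumr mulrC ler_wpM2r // lerDr.
Qed.

Lemma norm_tsubC (R : realType) d (nrm : d.-tuple R -> R) : is_norm nrm ->
  forall x y, nrm (tsub x y) = nrm (tsub y x).
Proof.
move=> [_ _ nZ _] x y.
have -> : tsub x y = tscale (-1) (tsub y x).
  by apply/eq_from_tnth => i; rewrite !tnth_mktuple; ring.
by rewrite nZ normrN1 mul1r.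
Qed.

Lemma norm_tsub_triangle (R : realType) d (nrm : d.-tuple R -> R) : is_norm nrm ->
  forall x y z, nrm (tsub x z) <= nrm (tsub x y) + nrm (tsub y z).
Proof.
move=> [_ _ _ nD] x y z.
have -> : tsub x z = tadd (tsub x y) (tsub y z).
  by apply/eq_from_tnth => i; rewrite !tnth_mktuple; ring.
exact: nD.
Qed.

Lemma measurable_nball (R : realType) d (nrm : d.-tuple R -> R) : is_norm nrm ->
  forall x r, measurable (nball nrm x r).
Proof.
move=> nn x r; rewrite -[nball _ _ _]setCK; apply: measurableC.
have [c c0 cn] := norm_coord_bound nn.
apply: measurable_tuple_open => y /negP; rewrite -ltNge => ry.
exists ((nrm (tsub y x) - r) / (2 * c)).
  by rewrite divr_gt0 ?subr_gt0 // mulr_gt0.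
move=> z zy zx; have := norm_tsub_triangle nn y z x.
have : nrm (tsub y z) <= c * ((nrm (tsub y x) - r) / (2 * c)).
  apply: cn => [|i]; first by rewrite divr_ge0 ?subr_ge0 ?mulr_ge0 // ltW.
  by rewrite tnth_mktuple distrC ltW.
have -> : c * ((nrm (tsub y x) - r) / (2 * c)) = (nrm (tsub y x) - r) / 2.
  by field; rewrite gt_eqF.
by move: zx; rewrite /nball /=; lra.
Qed.

(* [nrm] attains a positive minimum on each face [u_i = 1] of the unit cube. *)
Lemma coord_norm_bound (R : realType) d (nrm : d.-tuple R -> R) : is_norm nrm ->
  exists2 c, 0 < c & forall (x : d.-tuple R) i, `|tnth x i| <= c * nrm x.
Proof.
move=> nn; have [n0 neq0 nZ nD] := nn.
have [c c0 cn] := norm_coord_bound nn.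
pose tr (u : 'rV[R]_d) : d.-tuple R := mktuple (u ord0).
pose g u := nrm (tr u).
have gc : continuous g.
  move=> u A /nbhs_ballP[e' /= e'0 eA]; pose e := e' / 2.
  have e0 : 0 < e by rewrite divr_gt0.
  apply/nbhs_ballP; exists (e / c) => /=; first by rewrite divr_gt0.
  move=> v [_ uv]; apply: eA.
  have {}uv : nrm (tsub (tr u) (tr v)) <= e.
    have -> : e = c * (e / c) by field; rewrite gt_eqF.
    apply: cn => [|i]; first by rewrite divr_ge0 // ltW.
    by rewrite !tnth_mktuple; apply/ltW; exact: uv.
  have tg a b : nrm a <= nrm (tsub a b) + nrm b.
    have -> : nrm a = nrm (tadd (tsub a b) b).
      by congr nrm; apply/eq_from_tnth => i; rewrite !tnth_mktuple; ring.
    exact: nD.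
  have := tg (tr u) (tr v); have := tg (tr v) (tr u).
  rewrite (norm_tsubC nn (tr v)) /g /ball /= ltr_norml => h1 h2.
  have : e = e' / 2 by [].
  by move=> ?; apply/andP; split; lra.
pose face i : set 'rV[R]_d := [set u | forall j,
  (if j == i then [set 1 : R] else `[-1, 1]%classic) (u ord0 j)].
have face_min i : exists2 m, 0 < m & forall u, face i u -> m <= g u.
  have face_compact : compact (face i).
    apply: (@rV_compact R d (fun j => if j == i then [set 1 : R] else `[-1, 1]%classic)).
    by move=> j; case: ifP => _; [exact: compact_set1|exact: segment_compact].
  have face0 : face i !=set0.
    exists (const_mx 1) => j; rewrite mxE; case: ifP => //= _.
    by rewrite in_itv /= lexx andbT; lra.
  have [u uf umin] := compact_EVT_min face0 face_compact (continuous_subspaceT gc).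
  rewrite inE in uf; exists (g u) => [|v vf]; last by apply: umin; rewrite inE.
  rewrite lt_neqAle n0 andbT eq_sym; apply/eqP => /neq0 /(congr1 (fun t => tnth t i)).
  rewrite !tnth_mktuple; have := uf i; rewrite eqxx /= => -> /eqP.
  by rewrite oner_eq0.
have {face_min}[m m0 mg] := fin_all_exists2 face_min.
exists (1 + \sum_i (m i)^-1).
  by rewrite ltr_pwDl ?ltr01 // sumr_ge0 // => i _; rewrite invr_ge0 ltW.
(* Division by the coordinate of largest absolute value puts [x] on the face of index [j], and that
   coordinate dominates all others. *)
move=> x i; have [j _ jmax] := @arg_maxP _ _ _ i xpredT (fun j => `|tnth x j|) isT.
apply: le_trans (jmax i isT) _.
have [->|xj] := eqVneq (tnth x j) 0.
  rewrite normr0 mulr_ge0 ?n0 // addr_ge0 // sumr_ge0 // => k _.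
  by rewrite invr_ge0 ltW.
pose u : 'rV[R]_d := \row_k (tnth x k / tnth x j).
have uf : face j u.
  move=> k; rewrite mxE; case: eqVneq => [-> /=|_ /=]; first by rewrite divff.
  rewrite in_itv /= -ler_norml normrM normfV ler_pdivrMr ?normr_gt0 // mul1r.
  exact: jmax.
have := mg j u uf; have -> : g u = `|tnth x j|^-1 * nrm x.
  rewrite -normfV -nZ; congr nrm; apply/eq_from_tnth => k.
  by rewrite !tnth_mktuple mxE mulrC.
rewrite ler_pdivlMl ?normr_gt0 // -ler_pdivlMr // mulrC => h.
apply: le_trans h _; apply: ler_wpM2r; first exact: n0.
rewrite (bigD1 j) //= addrCA lerDl addr_ge0 // sumr_ge0 // => k _.
by rewrite invr_ge0 ltW.
Qed.

Definition ball_map (R : realType) d (x : d.-tuple R) (r : R) (u : d.-tuple R) :=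
  tadd x (tscale r u).

Lemma measurable_ball_map (R : realType) d (x : d.-tuple R) r :
  measurable_fun setT (ball_map x r).
Proof.
apply/measurable_fun_tnthP => i.
rewrite [X in measurable_fun _ X](_ : _ = fun u => tnth x i + r * tnth u i); last first.
  by apply/funext => u; rewrite /= !tnth_mktuple.
apply: measurable_funD => //; apply: measurable_funM => //.
exact: measurable_tnth.
Qed.

Lemma tbox_set0 (R : realType) d (a b : d.-tuple R) :
  ~ (forall i, tnth a i <= tnth b i) -> tbox a b = set0.
Proof.
move=> ab; apply/seteqP; split => // x xab; apply: ab => i.
by have /andP[] := xab i; exact: le_trans.
Qed.

Lemma tboxI (R : realType) d (a b a' b' : d.-tuple R) :
  tbox a b `&` tbox a' b' =
  tbox (mktuple (fun i => Num.max (tnth a i) (tnth a' i)))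
       (mktuple (fun i => Num.min (tnth b i) (tnth b' i))).
Proof.
apply/seteqP; split => [x [h h'] i | x h].
  rewrite !tnth_mktuple ge_max le_min.
  by have /andP[-> ->] := h i; have /andP[-> ->] := h' i.
split => i; have := h i; rewrite !tnth_mktuple ge_max le_min.
  by move=> /andP[/andP[-> _] /andP[-> _]].
by move=> /andP[/andP[_ ->] /andP[_ ->]].
Qed.

(** Both sides are measures in [A]. They agree on boxes, which are closed under intersection and
    generate the sigma-algebra, and they are finite on the cubes [g n] exhausting the space, so they
    coincide. *)
Lemma lebesgue_ball_map (R : realType) d (lam : {measure set (d.-tuple R) -> \bar R}) :
  is_lebesgue lam -> forall x r (A : set (d.-tuple R)), 0 < r -> measurable A ->
  lam A = ((r ^+ d)%:E * lam (ball_map x r @^-1` A))%E.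
Proof.
move=> lamE x r A r0 mA.
have rd0 : 0 <= r ^+ d by rewrite exprn_ge0 // ltW.
have [m2 m2E] : exists m : {measure set (d.-tuple R) -> \bar R},
    forall A, m A = ((r ^+ d)%:E * lam (ball_map x r @^-1` A))%E.
  unshelve eexists (mscale (NngNum rd0)
    (pushforward lam (ball_map x r) : {measure set (d.-tuple R) -> \bar R})) => //.
  exact: measurable_ball_map.
rewrite -m2E.
pose g n : set (d.-tuple R) := tbox (mktuple (fun=> - n%:R)) (mktuple (fun=> n%:R)).
apply: (measure_unique (range (fun ab => @tbox R d ab.1 ab.2)) g) => //.
- exact: tuple_measurableE.
- by move=> _ _ [[a b] _ <-] [[a' b'] _ <-]; rewrite /= tboxI; eexists (_, _).
- by move=> n; eexists (_, _).
- apply/seteqP; split => // y _; pose B : R := \sum_j `|tnth y j|.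
  exists (Num.trunc B).+1 => //= j; rewrite !tnth_mktuple -ler_norml.
  apply: le_trans (ltW (truncnS_gt B)).
  by rewrite /B (bigD1 j) //= lerDl sumr_ge0.
- move=> _ [[a b] _ <-] /=; rewrite m2E.
  have [ab|ab] := pselect (forall i, tnth a i <= tnth b i); last first.
    by rewrite (tbox_set0 ab) preimage_set0 !measure0 mule0.
  pose sc (c : d.-tuple R) := mktuple (fun i => (tnth c i - tnth x i) / r).
  have -> : ball_map x r @^-1` tbox a b = tbox (sc a) (sc b).
    apply/seteqP; split => y /= h i; have := h i; rewrite !tnth_mktuple.
      by rewrite ler_pdivrMr // ler_pdivlMr // => /andP[? ?]; apply/andP; split; lra.
    by rewrite ler_pdivrMr // ler_pdivlMr // => /andP[? ?]; apply/andP; split; lra.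
  rewrite !lamE //; last first.
    by move=> i; rewrite !tnth_mktuple ler_pM2r ?invr_gt0 // lerD2r.
  rewrite -EFinM; congr EFin.
  rewrite [X in X * _](_ : _ = \prod_(i < d) r); last first.
    by rewrite prodr_const card_ord.
  rewrite -big_split /=; apply: eq_bigr => i _; rewrite !tnth_mktuple.
  by field; rewrite gt_eqF.
- move=> n; rewrite /g lamE ?ltry // => i; rewrite !tnth_mktuple.
  by rewrite ge0_cp // ler0n.
Qed.

(** [vol_unit_ball] is a [fine], hence meaningful only once the unit ball has finite measure. Cubes
    inside and outside the ball give positivity and finiteness; scaling gives the other radii. *)
Lemma lebesgue_nball (R : realType) d (nrm : d.-tuple R -> R)
    (lam : {measure set (d.-tuple R) -> \bar R}) :
  is_norm nrm -> is_lebesgue lam -> 0 < vol_unit_ball nrm lam /\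
  forall x r, 0 < r -> lam (nball nrm x r) = (vol_unit_ball nrm lam * r ^+ d)%:E.
Proof.
move=> nn lamE; have [n0 _ nZ _] := nn.
have [c c0 cn] := norm_coord_bound nn.
have [c' c'0 nc] := coord_norm_bound nn.
have mB : measurable (nball nrm (tzero R d) 1) by exact: measurable_nball.
have t0 x : tsub x (tzero R d) = x.
  by apply/eq_from_tnth => i; rewrite !tnth_mktuple subr0.
have lo : ((\prod_(i < d) (2 / c))%:E <= lam (nball nrm (tzero R d) 1))%E.
  have := lamE (mktuple (fun=> - c^-1)) (mktuple (fun=> c^-1)).
  rewrite (eq_bigr (fun=> 2 / c)); last first.
    by move=> i _; rewrite !tnth_mktuple; field; rewrite gt_eqF.
  move=> <-; last first.
    by move=> i; rewrite !tnth_mktuple ge0_cp // invr_ge0 ltW.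
  apply: le_measure; rewrite ?inE //; first exact: measurable_tbox.
  move=> x /= h; rewrite /nball /= t0 -(mulfV (lt0r_neq0 c0)).
  apply: cn => [|i]; first by rewrite invr_ge0 ltW.
  by have := h i; rewrite !tnth_mktuple -ler_norml.
have hi : (lam (nball nrm (tzero R d) 1) < +oo)%E.
  apply: le_lt_trans (ltry (\prod_(i < d) (2 * c'))).
  have := lamE (mktuple (fun=> - c')) (mktuple (fun=> c')).
  rewrite (eq_bigr (fun=> 2 * c')); last first.
    by move=> i _; rewrite !tnth_mktuple; ring.
  move=> <-; last by move=> i; rewrite !tnth_mktuple ge0_cp // ltW.
  apply: le_measure; rewrite ?inE //; first exact: measurable_tbox.
  move=> x; rewrite /nball /= t0 => x1 i; rewrite !tnth_mktuple -ler_norml.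
  apply: le_trans (nc x i) _; rewrite -[leRHS]mulr1; apply: ler_wpM2l => //.
  exact: ltW.
have fin : lam (nball nrm (tzero R d) 1) = (vol_unit_ball nrm lam)%:E.
  by rewrite fineK // ge0_fin_numE.
split.
  rewrite -lte_fin -fin; apply: lt_le_trans lo; rewrite lte_fin.
  by apply: prodr_gt0 => i _; rewrite divr_gt0.
move=> x r r0; rewrite (lebesgue_ball_map lamE x r0); last exact: measurable_nball.
rewrite (_ : _ @^-1` _ = nball nrm (tzero R d) 1); last first.
  apply/seteqP; split => u; rewrite /nball /= t0.
    have -> : tsub (ball_map x r u) x = tscale r u.
      by apply/eq_from_tnth => i; rewrite !tnth_mktuple; ring.
    by rewrite nZ gtr0_norm // -ler_pdivlMl // mulVf // gt_eqF.
  have -> : tsub (ball_map x r u) x = tscale r u.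
    by apply/eq_from_tnth => i; rewrite !tnth_mktuple; ring.
  by rewrite nZ gtr0_norm // -ler_pdivlMl // mulVf // gt_eqF.
by rewrite fin -EFinM mulrC.
Qed.

(** * Densities and independence *)

Section nomeas.
Import HBNNSimple.

(* Unlike [ge0_le_integral], no measurability is required: the integral of a
   nonnegative function is a supremum over simple functions below it. *)
Lemma ge0_le_integral_nomeas (R : realType) d0 (T : measurableType d0)
    (mu : {measure set T -> \bar R}) (D : set T) (f g : T -> \bar R) :
  (forall x, D x -> (0 <= f x)%E) -> (forall x, D x -> (f x <= g x)%E) ->
  (\int[mu]_(x in D) f x <= \int[mu]_(x in D) g x)%E.
Proof.
move=> f0 fg; have g0 x : D x -> (0 <= g x)%E.
  by move=> Dx; apply: le_trans (fg x Dx); exact: f0.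
rewrite (integral_mkcond D f) (integral_mkcond D g).
rewrite !ge0_integralTE; try by move=> x; apply: erestrict_ge0.
apply: le_ereal_sup => _ [h hf <-]; exists h => // x.
apply: le_trans (hf x) _; rewrite /patch; case: ifPn => // xD.
by apply: fg; rewrite inE in xD.
Qed.

End nomeas.

Section density.
Context (R : realType) (d : nat) (d0 : measure_display) (Omega : measurableType d0)
  (P : probability Omega R) (lam : {measure set (d.-tuple R) -> \bar R})
  (X : Omega -> d.-tuple R) (f : d.-tuple R -> R).
Hypotheses (Xf : has_density P lam X f) (f0 : forall x, 0 <= f x).

Lemma density_le (c : R) (A : set (d.-tuple R)) : measurable A ->
  (forall x, f x <= c) -> (P (X @^-1` A) <= c%:E * lam A)%E.
Proof.
move=> mA fc; rewrite Xf // -integral_cst //.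
by apply: ge0_le_integral_nomeas => x _; rewrite lee_fin.
Qed.

Lemma density_ge (c : R) (A S : set (d.-tuple R)) : 0 <= c ->
  measurable A -> measurable S ->
  (forall x, S x -> c <= f x) -> (c%:E * lam (A `&` S) <= P (X @^-1` A))%E.
Proof.
move=> c0 mA mS fc; rewrite Xf // -integral_cst //; last exact: measurableI.
rewrite [leLHS]integral_mkcondr.
apply: ge0_le_integral_nomeas => x _.
  by rewrite /patch; case: ifP => // _; rewrite lee_fin.
rewrite /patch; case: ifPn => xS; rewrite lee_fin //.
by apply: fc; rewrite inE in xS.
Qed.

Lemma density_support (S : set (d.-tuple R)) : measurable S ->
  (forall x, ~ S x -> f x = 0) -> P (X @^-1` (~` S)) = 0%E.
Proof.
move=> mS fS; rewrite Xf; last exact: measurableC.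
by rewrite integral0_eq // => x /fS ->.
Qed.

End density.

Section weighted_integral_comp.
Import HBNNSimple.
Context (R : realType) d0 d1 (Omega : measurableType d0) (S : measurableType d1)
  (mu : {measure set Omega -> \bar R}) (V : Omega -> S).
Hypothesis mV : measurable_fun setT V.

(* The absolute values make every term of the sum manifestly nonnegative. *)
Lemma weighted_integral_nnsfun (Z : Omega -> R) (g : {nnsfun S >-> R}) :
  measurable_fun setT Z -> (forall w, 0 <= Z w) ->
  (\int[mu]_w (Z w * g (V w))%:E = \sum_(y \in range g)
     (`|y|%:E * \int[mu]_w (Z w * \1_(g @^-1` [set y]) (V w))%:E))%E.
Proof.
move=> mZ Z0.
have mi y : measurable_fun setT (fun w => (Z w * \1_(g @^-1` [set y]) (V w))%:E).
  apply/measurable_EFinP; apply: measurable_funM => //.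
  by apply: (measurableT_comp _ mV); exact: measurable_indic.
have i0 y w : (0 <= (Z w * \1_(g @^-1` [set y]) (V w))%:E)%E.
  by rewrite lee_fin mulr_ge0.
transitivity (\int[mu]_w (\sum_(y \in range g)
    (`|y|%:E * (Z w * \1_(g @^-1` [set y]) (V w))%:E)))%E.
  apply: eq_integral => w _; rewrite fimfunE.
  rewrite (eq_fsbigr (fun y => `|y| * \1_(g @^-1` [set y]) (V w))); last first.
    by move=> y; rewrite inE => -[x _ <-]; rewrite ger0_norm.
  rewrite fsbig_finite //= mulr_sumr -sumEFin.
  rewrite fsbig_finite //=; apply: eq_bigr => y _; rewrite -EFinM; congr EFin; ring.
have mi' y : measurable_fun setT
    (fun w => `|y|%:E * (Z w * \1_(g @^-1` [set y]) (V w))%:E)%E.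
  exact: measurable_funeM.
have i0' y w : setT w -> (0 <= `|y|%:E * (Z w * \1_(g @^-1` [set y]) (V w))%:E)%E.
  by move=> _; rewrite mule_ge0 // lee_fin.
rewrite (ge0_integral_fsum mu measurableT mi' i0') //.
by apply: eq_fsbigr => y _; rewrite ge0_integralZl_EFin.
Qed.

Lemma weighted_integral_approx (Z : Omega -> R) (psi : S -> R)
    (mpsi : measurable_fun setT (EFin \o psi)) :
  measurable_fun setT Z -> (forall w, 0 <= Z w) -> (forall x, 0 <= psi x) ->
  (\int[mu]_w (Z w * psi (V w))%:E = limn (fun n =>
     \int[mu]_w (Z w * nnsfun_approx measurableT mpsi n (V w))%:E))%E.
Proof.
move=> mZ Z0 psi0.
pose g n w := (Z w * nnsfun_approx measurableT mpsi n (V w))%:E.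
have mg n : measurable_fun setT (g n).
  apply/measurable_EFinP; apply: measurable_funM => //.
  exact: (measurableT_comp _ mV).
have g0 n w : setT w -> (0 <= g n w)%E by move=> _; rewrite lee_fin mulr_ge0.
have ng w : setT w -> nondecreasing_seq (g^~ w).
  move=> _ m n mn; rewrite lee_fin ler_wpM2l //; exact/lefP/nd_nnsfun_approx.
rewrite -(monotone_convergence mu measurableT mg g0 ng).
apply: eq_integral => w _; apply/esym/cvg_lim; first exact: ereal_hausdorff.
rewrite EFinM /g; under eq_fun do rewrite EFinM.
apply: cvgeZl => //.
by apply: cvg_nnsfun_approx => // x _; rewrite lee_fin.
Qed.

(** Passes from indicators to simple functions by linearity and to general [psi] by monotone limits.
    This allows one random factor to be treated at a time without product measures. *)
Lemma weighted_integral_eq (Z1 Z2 : Omega -> R) (psi : S -> R) :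
  measurable_fun setT Z1 -> measurable_fun setT Z2 -> measurable_fun setT psi ->
  (forall w, 0 <= Z1 w) -> (forall w, 0 <= Z2 w) -> (forall x, 0 <= psi x) ->
  (forall B, measurable B -> (\int[mu]_w (Z1 w * \1_B (V w))%:E =
     \int[mu]_w (Z2 w * \1_B (V w))%:E)%E) ->
  (\int[mu]_w (Z1 w * psi (V w))%:E = \int[mu]_w (Z2 w * psi (V w))%:E)%E.
Proof.
move=> mZ1 mZ2 mpsi Z10 Z20 psi0 Zeq.
have mpsiE : measurable_fun setT (EFin \o psi) by exact/measurable_EFinP.
rewrite !(weighted_integral_approx mpsiE) //; congr (limn _).
apply/funext => n; rewrite !weighted_integral_nnsfun //.
by apply: eq_fsbigr => y _; rewrite Zeq.
Qed.

End weighted_integral_comp.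

Section independence.
Context (R : realType) (d : nat) (d0 : measure_display) (Omega : measurableType d0)
  (P : probability Omega R) (N : nat) (X : 'I_N -> Omega -> d.-tuple R)
  (W : 'I_N -> Omega -> R).
Hypotheses (mX : forall i, measurable_fun setT (X i))
  (mW : forall i, measurable_fun setT (W i))
  (indep : mutually_independent P X W).

Lemma measurable_fun_indicX (A : set (d.-tuple R)) i : measurable A ->
  measurable_fun setT (fun w => \1_A (X i w) : R).
Proof. by move=> mA; apply: (measurableT_comp _ (mX i)); exact: measurable_indic. Qed.

(** Independence is given for events only, so the indicators of noise events are replaced by general
    functions one index at a time. *)
Lemma integral_prod_independent (A : 'I_N -> set (d.-tuple R)) (psi : 'I_N -> R -> R)
    (m : 'I_N -> R) :
  (forall i, measurable (A i)) -> (forall i, measurable_fun setT (psi i)) ->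
  (forall i x, 0 <= psi i x) ->
  (forall i, (\int[P]_w (psi i (W i w))%:E = (m i)%:E)%E) ->
  (\int[P]_w (\prod_i (\1_(A i) (X i w) * psi i (W i w)))%:E =
   (\prod_i (fine (P (X i @^-1` A i)) * m i))%:E)%E.
Proof.
move=> mA.
(* Only the noise factors of index below [k] may be general; the others are indicators, so that
   [k = 0] is the assumed product rule. *)
suff H k : (forall i, measurable_fun setT (psi i)) ->
  (forall i x, 0 <= psi i x) ->
  (forall i, (\int[P]_w (psi i (W i w))%:E = (m i)%:E)%E) ->
  (forall i : 'I_N, (k <= i)%N -> exists2 B, measurable B & psi i = \1_B) ->
  (\int[P]_w (\prod_i (\1_(A i) (X i w) * psi i (W i w)))%:E =
   (\prod_i (fine (P (X i @^-1` A i)) * m i))%:E)%E.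
  by move=> mpsi psi0 psim; apply: (H N) => // i; rewrite leqNgt ltn_ord.
have indicW B i : measurable B ->
    (\int[P]_w (\1_B (W i w))%:E = (fine (P (W i @^-1` B)))%:E)%E.
  move=> mB; have mWB : measurable (W i @^-1` B).
    by rewrite -[X in measurable X]setTI; exact: mW.
  rewrite fineK ?fin_num_measure // -[in RHS](setIT (W i @^-1` B)).
  by rewrite -integral_indic //; apply: eq_integral => w _; rewrite !indicE.
elim: k psi m => [|k IH] psi m mpsi psi0 psim psiB.
  have {psiB}[B mB psiB] := fin_all_exists2 (fun i => psiB i (leq0n _)).
  transitivity (P (\bigcap_i (X i @^-1` A i `&` W i @^-1` B i))); last first.
    rewrite indep //; congr EFin; apply: eq_bigr => i _; congr (_ * _).
    by apply: EFin_inj; rewrite -psim psiB indicW.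
  have mE : measurable (\bigcap_i (X i @^-1` A i `&` W i @^-1` B i)).
    apply: fin_bigcap_measurable => // i _; apply: measurableI.
      by rewrite -[X in measurable X]setTI; exact: mX.
    by rewrite -[X in measurable X]setTI; exact: mW.
  rewrite -[in RHS](setIT (\bigcap_i _)) -integral_indic //.
  apply: eq_integral => w _; congr EFin; rewrite [RHS]indicE.
  case: (boolP (w \in _)) => [|/negP]; rewrite inE => wE.
    rewrite big1 // => i _; have [wA wB] := wE i Logic.I.
    by rewrite psiB !indicE !mem_set // mulr1.
  have /existsNP[i wi] : ~ (forall i, (X i @^-1` A i `&` W i @^-1` B i) w).
    by apply: contra_not wE => h i _.
  rewrite (bigD1 i) //= psiB !indicE.
  have [wA|wA] := pselect (A i (X i w)); last by rewrite memNset ?mul0r.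
  have [wB|wB] := pselect (B i (W i w)); last by rewrite (memNset wB) mulr0 mul0r.
  by case: wi.
have [kN|Nk] := ltnP k N; last first.
  by apply: IH => // i ki; have := leq_trans Nk ki; rewrite leqNgt ltn_ord.
pose i0 := Ordinal kN.
(* [Z] is the product without the noise factor of index [k], and [c] is its expectation. The
   induction hypothesis, with that factor set to [\1_B], shows that [Z] may be replaced by [c]
   against functions of [W i0]. *)
pose Z w := (\prod_(i | i != i0) (\1_(A i) (X i w) * psi i (W i w))) *
  \1_(A i0) (X i0 w).
pose c := (\prod_(i | i != i0) (fine (P (X i @^-1` A i)) * m i)) *
  fine (P (X i0 @^-1` A i0)).
have mZ : measurable_fun setT Z.
  apply: measurable_funM; last exact: measurable_fun_indicX.
  rewrite /Z (_ : (fun w => _) = fun w => \prod_(i <- [seq i <- index_enum 'I_N | i != i0])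
      (\1_(A i) (X i w) * psi i (W i w))); last first.
    by apply/funext => w; rewrite big_filter.
  apply: measurable_prod => i _; apply: measurable_funM.
    exact: measurable_fun_indicX.
  exact: (measurableT_comp (mpsi i) (mW i)).
have m0 i : 0 <= m i.
  by rewrite -lee_fin -psim; apply: integral_ge0 => w _; rewrite lee_fin.
have c0 : 0 <= c.
  apply: mulr_ge0; last by rewrite fine_ge0.
  by apply: prodr_ge0 => i _; apply: mulr_ge0 => //; rewrite fine_ge0.
have Z0 w : 0 <= Z w.
  by apply: mulr_ge0 => //; apply: prodr_ge0 => i _; apply: mulr_ge0.
transitivity (\int[P]_w (Z w * psi i0 (W i0 w))%:E)%E.
  by apply: eq_integral => w _; rewrite (bigD1 i0) //= /Z; congr EFin; ring.
rewrite (@weighted_integral_eq _ _ _ _ _ P (W i0) (mW i0) Z (cst c)) //; last first.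
  move=> B mB.
  pose psi' i : R -> R := if i == i0 then \1_B else psi i.
  pose m' i := if i == i0 then fine (P (W i0 @^-1` B)) else m i.
  transitivity (\int[P]_w (\prod_i (\1_(A i) (X i w) * psi' i (W i w)))%:E)%E.
    apply: eq_integral => w _; rewrite (bigD1 i0) //= /psi' eqxx /Z.
    rewrite [in RHS](eq_bigr (fun i => \1_(A i) (X i w) * psi i (W i w))).
      by congr EFin; ring.
    by move=> i /negbTE ->.
  rewrite (IH psi' m') /psi' /m'; last 4 first.
  - by move=> i; case: eqP => _ //; exact: measurable_indic.
  - by move=> i x; case: eqP.
  - by move=> i; case: eqVneq => [->|_]; rewrite ?indicW.
  - move=> i ki; case: eqVneq => [_|ii0]; first by exists B.
    by apply: psiB; rewrite ltn_neqAle ki andbT eq_sym; apply: contra ii0 => /eqP ik; apply/eqP/val_inj.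
  rewrite (bigD1 i0) //= eqxx.
  rewrite (eq_bigr (fun i => fine (P (X i @^-1` A i)) * m i)); last by move=> i /negbTE ->.
  rewrite [RHS](_ : _ = \int[P]_w (c%:E * (\1_B (W i0 w))%:E))%E; last first.
    by apply: eq_integral => w _; rewrite EFinM.
  rewrite ge0_integralZl_EFin // ?indicW //.
    by rewrite -EFinM; congr EFin; rewrite /c; ring.
  apply/measurable_EFinP; apply: (measurableT_comp _ (mW i0)); exact: measurable_indic.
rewrite [LHS](_ : _ = \int[P]_w (c%:E * (psi i0 (W i0 w))%:E))%E; last first.
  by apply: eq_integral => w _; rewrite EFinM.
rewrite ge0_integralZl_EFin //; last 2 first.
- by move=> w _; rewrite lee_fin.
- by apply/measurable_EFinP; exact: (measurableT_comp (mpsi i0) (mW i0)).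
by rewrite psim -EFinM (bigD1 i0) //=; congr EFin; rewrite /c; ring.
Qed.

End independence.

(** * Exponential moments and tail bounds *)

Lemma measurable_superlevel (R : realType) d0 (Omega : measurableType d0)
    (S : Omega -> R) (a : R) : measurable_fun setT S -> measurable [set w | a <= S w].
Proof.
move=> mS; rewrite (_ : [set w | _] = S @^-1` `[a, +oo[).
  by rewrite -[X in measurable X]setTI; apply: mS.
by apply/seteqP; split => w /=; rewrite in_itv /= andbT.
Qed.

Lemma exp_markov (R : realType) d0 (Omega : measurableType d0) (P : probability Omega R)
    (S : Omega -> R) (c a : R) : measurable_fun setT S ->
  (\int[P]_w (expR (S w))%:E <= c%:E)%E ->
  (P [set w | (a <= S w)%R] <= (c * expR (- a))%:E)%E.
Proof.
move=> mS I.
have mE := measurable_superlevel a mS.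
have : ((expR a)%:E * P [set w | (a <= S w)%R] <= c%:E)%E.
  apply: le_trans I; rewrite -integral_cst //.
  rewrite [leLHS]integral_mkcond; apply: ge0_le_integral_nomeas => w _.
    by rewrite /patch; case: ifP => // _; rewrite lee_fin expR_ge0.
  rewrite /patch; case: ifPn; rewrite lee_fin ?expR_ge0 // inE /= => aS.
  by rewrite ler_expR.
have mEf : P [set w | (a <= S w)%R] \is a fin_num by rewrite fin_num_measure.
rewrite -(fineK mEf) -EFinM !lee_fin expRN => h.
by rewrite ler_pdivlMr ?expR_gt0 // mulrC.
Qed.

Section chernoff.
Context (R : realType) (d : nat) (d0 : measure_display) (Omega : measurableType d0)
  (P : probability Omega R) (N : nat) (X : 'I_N -> Omega -> d.-tuple R)
  (W : 'I_N -> Omega -> R).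
Hypotheses (mX : forall i, measurable_fun setT (X i))
  (mW : forall i, measurable_fun setT (W i))
  (indep : mutually_independent P X W).

(** The product is expanded over all choices of which points fall in [B], each term is integrated by
    independence, and the sum is factored again. One factor has mean [(1 - p) + p * m], where [p] is
    the probability of [B]. *)
Lemma integral_prod_thinned (B : set (d.-tuple R)) (psi : R -> R) (m : 'I_N -> R) :
  measurable B -> measurable_fun setT psi -> (forall x, 0 <= psi x) ->
  (forall i, (\int[P]_w (psi (W i w))%:E = (m i)%:E)%E) ->
  (\int[P]_w (\prod_i (\1_(~` B) (X i w) + \1_B (X i w) * psi (W i w)))%:E =
   (\prod_i (1 + fine (P (X i @^-1` B)) * (m i - 1)))%:E)%E.
Proof.
move=> mB mpsi psi0 psim.
pose A (b : bool) := if b then B else ~` B.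
pose ps (b : bool) : R -> R := if b then psi else cst 1.
pose mm (b : bool) i := if b then m i else 1.
have mA b : measurable (A b) by case: b => //; exact: measurableC.
have mps b : measurable_fun setT (ps b) by case: b => //.
have ps0 b x : 0 <= ps b x by case: b => /=.
have psmm b i : (\int[P]_w (ps b (W i w))%:E = (mm b i)%:E)%E.
  by case: b => //=; rewrite integral_cst // mul1e; exact: probability_setT.
pose G (f : {ffun 'I_N -> bool}) w :=
  \prod_i (\1_(A (f i)) (X i w) * ps (f i) (W i w)).
have mG f : measurable_fun setT (fun w => (G f w)%:E).
  apply/measurable_EFinP; apply: measurable_prod => i _; apply: measurable_funM.
    exact: measurable_fun_indicX.
  exact: (measurableT_comp (mps _) (mW i)).
have G0 f w : setT w -> (0 <= (G f w)%:E)%E.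
  by move=> _; rewrite lee_fin; apply: prodr_ge0 => i _; apply: mulr_ge0.
transitivity (\int[P]_w (\sum_(f : {ffun 'I_N -> bool}) (G f w)%:E))%E.
  apply: eq_integral => w _; rewrite sumEFin; congr EFin.
  rewrite -(bigA_distr_bigA (fun i b => \1_(A b) (X i w) * ps b (W i w))) /=.
  by apply: eq_bigr => i _; rewrite big_bool /= mulr1 addrC.
rewrite (ge0_integral_sum P measurableT mG G0) /=.
rewrite (eq_bigr (fun f : {ffun 'I_N -> bool} =>
    (\prod_i (fine (P (X i @^-1` A (f i))) * mm (f i) i))%:E)); last first.
  by move=> f _; apply: (integral_prod_independent mX mW indep (fun i => mA (f i))
    (fun i => mps (f i)) (fun i => ps0 (f i)) (fun i => psmm (f i) i)).
rewrite sumEFin; congr EFin.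
rewrite -(bigA_distr_bigA (fun i b => fine (P (X i @^-1` A b)) * mm b i)) /=.
apply: eq_bigr => i _; rewrite big_bool /= mulr1.
have mXB : measurable (X i @^-1` B) by rewrite -[X in measurable X]setTI; exact: mX.
rewrite preimage_setC probability_setC // fineB // ?fin_num_measure //=.
by ring.
Qed.

(** The exponential of the sum is a product as in [integral_prod_thinned], each factor of mean at
    most [1 + t <= expR t]. A linear [phi] serves noise sums, [phi = 1] upper tails of counts and
    [phi = - 1] lower tails. *)
Lemma chernoff_thinned_sum (B : set (d.-tuple R)) (phi : R -> R) (m : 'I_N -> R)
    (t a : R) :
  measurable B -> measurable_fun setT phi ->
  (forall i, (\int[P]_w (expR (phi (W i w)))%:E = (m i)%:E)%E) ->
  (forall i, fine (P (X i @^-1` B)) * (m i - 1) <= t) ->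
  (P [set w | (a <= \sum_i \1_B (X i w) * phi (W i w))%R] <=
     (expR (N%:R * t - a))%:E)%E.
Proof.
move=> mB mphi phim mt; set S := fun w => \sum_i \1_B (X i w) * phi (W i w).
have mS : measurable_fun setT S.
  apply: measurable_sum => i; apply: measurable_funM.
    exact: measurable_fun_indicX.
  exact: (measurableT_comp mphi (mW i)).
have mexp : measurable_fun setT (fun x => expR (phi x)).
  by apply: measurableT_comp => //; exact: measurable_expR.
have m0 i : 0 <= m i.
  by rewrite -lee_fin -phim; apply: integral_ge0 => w _; rewrite lee_fin expR_ge0.
have I : (\int[P]_w (expR (S w))%:E <= (expR (N%:R * t))%:E)%E.
  have -> : (\int[P]_w (expR (S w))%:E =
      \int[P]_w (\prod_i (\1_(~` B) (X i w) + \1_B (X i w) * expR (phi (W i w))))%:E)%E.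
    apply: eq_integral => w _; rewrite /S expR_sum; congr EFin; apply: eq_bigr => i _.
    rewrite !indicE in_setC; case: (_ \in B) => /=.
      by rewrite !mul1r add0r.
    by rewrite !mul0r addr0 expR0.
  rewrite (integral_prod_thinned mB mexp _ phim) => [|x]; last exact: expR_ge0.
  rewrite lee_fin expRM_natl; apply: (@le_trans _ _ (\prod_(i < N) expR t)).
    apply: ler_prod => i _; apply/andP; split.
      have mXB : measurable (X i @^-1` B) by rewrite -[X in measurable X]setTI; exact: mX.
      have : fine (P (X i @^-1` B)) <= 1.
        by rewrite -lee_fin fineK ?fin_num_measure //; exact: probability_le1.
      by have : 0 <= fine (P (X i @^-1` B)) := fine_ge0 (measure_ge0 _ _); have := m0 i; nra.
    apply: le_trans (expR_ge1Dx t); rewrite lerD2l; exact: mt.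
  by rewrite prodr_const card_ord.
rewrite expRD; exact: exp_markov.
Qed.

End chernoff.

(** * Packings and finite nets *)

Section net.
Context (R : realType) (d : nat) (nrm : d.-tuple R -> R) (d0 : measure_display)
  (Omega : measurableType d0) (P : probability Omega R) (X : Omega -> d.-tuple R).
Hypotheses (nn : is_norm nrm) (mX : measurable_fun setT X).

Let separated (e : R) := fun x y : d.-tuple R => e < nrm (tsub x y).

(** Balls of radius [e / 2] about points more than [e] apart are disjoint, so their probabilities
    add up to at most one. *)
Lemma packing_bound (e p : R) (s : seq (d.-tuple R)) :
  pairwise (separated e) s ->
  (forall y, y \in s -> p <= fine (P (X @^-1` nball nrm y (e / 2)))) ->
  (size s)%:R * p <= 1.
Proof.
move=> sep sp.
pose E (s : seq (d.-tuple R)) := \big[setU/set0]_(y <- s) (X @^-1` nball nrm y (e / 2)).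
have mB y : measurable (X @^-1` nball nrm y (e / 2)).
  by rewrite -[Y in measurable Y]setTI; apply: mX => //; exact: measurable_nball.
have mE s' : measurable (E s') by apply: bigsetU_measurable => y _; exact: mB.
have E1 : fine (P (E s)) <= 1.
  by rewrite -lee_fin fineK ?fin_num_measure //; exact: probability_le1.
apply: le_trans E1; elim: s sep sp => [|x s IH] /=.
  by rewrite mul0r fine_ge0.
move=> /andP[xs sep] sp; have disj : (X @^-1` nball nrm x (e / 2)) `&` E s = set0.
  apply/seteqP; split => // w /= [wx]; rewrite /E -bigcup_seq => -[y /= ys wy].
  have /(_ y ys) := allP xs; rewrite /separated ltNge => /negP; apply.
  apply: le_trans (norm_tsub_triangle nn x (X w) y) _.
  rewrite (norm_tsubC nn x); move: wx wy; rewrite /nball /=; lra.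
rewrite /E big_cons (measureU P (mB x) (mE s) disj).
rewrite fineD; [|exact/fin_num_measure/mB|exact/fin_num_measure/mE].
rewrite -natr1 mulrDl mul1r addrC; apply: lerD.
  by apply: sp; rewrite mem_head.
by apply: IH => // y ys; apply: sp; rewrite inE ys orbT.
Qed.

(** A separated list of maximal length is a net, since a point far from all its members could be
    added. The packing bound makes the maximum exist. *)
Lemma finite_net (S : set (d.-tuple R)) (e p : R) : 0 < p -> 0 <= e ->
  (forall x, S x -> p <= fine (P (X @^-1` nball nrm x (e / 2)))) ->
  exists s : seq (d.-tuple R), [/\ (forall y, y \in s -> S y),
    (size s)%:R * p <= 1 &
    forall x, S x -> exists2 y, y \in s & nrm (tsub x y) <= e].
Proof.
move=> p0 e0 Sp.
pose good (s : seq (d.-tuple R)) :=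
  pairwise (separated e) s /\ forall y, y \in s -> S y.
have good_size s : good s -> (size s)%:R * p <= 1.
  by move=> [sep sS]; apply: (packing_bound sep) => y /sS; exact: Sp.
pose Q n := `[< exists2 s, good s & size s = n >].
have Q0 : exists n, Q n by exists 0%N; apply/asboolP; exists [::].
have Qb n : Q n -> (n <= Num.trunc p^-1)%N.
  move=> /asboolP[s gs <-]; rewrite truncn_ge_nat ?invr_ge0 ?(ltW p0) //.
  by rewrite -div1r ler_pdivlMr // good_size.
have [n /asboolP[s gs sn] nmax] := ex_maxnP Q0 Qb.
exists s; split; [by case: gs|exact: good_size|move=> x Sx].
apply: contrapT => xs.
have : Q n.+1.
  apply/asboolP; exists (x :: s); last by rewrite /= sn.
  case: gs => sep sS; split => [|y]; last by rewrite inE => /predU1P[->//|/sS].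
  rewrite /= sep andbT; apply/allP => y ys; rewrite /separated ltNge.
  by apply/negP => xy; apply: xs; exists y.
by move/nmax; rewrite ltnn.
Qed.

End net.

(** * Good samples *)

(** Sized so that, when [x] and [y] are within [e] and the radius at [x] lies between [r] and
    [r + e], the balls about [x] and about [y] (of radius [r]) differ only inside the annulus about
    [y]. *)
Definition annulus (R : realType) d (nrm : d.-tuple R -> R) (x : d.-tuple R) (r e : R) :=
  nball nrm x (r + 2 * e) `\` nball nrm x (r - e).

Section good_sample.
Context (R : realType) (d N : nat) (nrm : d.-tuple R -> R) (net : seq (d.-tuple R))
  (Xset : set (d.-tuple R)) (Xs : 'I_N -> d.-tuple R) (Ws : 'I_N -> R)
  (h w b z n1 : R).
Let e := h / N%:R.
Hypotheses (nn : is_norm nrm) (N2 : (2 <= N)%N) (h0 : 0 < h)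
  (netP : forall x, Xset x -> exists2 y, y \in net & nrm (tsub x y) <= e).

(** All that the deterministic error bound requires of the sample. As [N * e = h], the grid radii
    [j * e] end exactly at [h]. *)
Definition good_sample :=
  [/\ forall i, Xset (Xs i),
      forall i, `|Ws i| <= w,
      forall y (j : 'I_N.+1), y \in net ->
        `|\sum_i \1_(nball nrm y (j%:R * e)) (Xs i) * Ws i| <= b,
      forall y (j : 'I_N.+1), y \in net ->
        \sum_i \1_(annulus nrm y (j%:R * e) e) (Xs i) <= z &
      forall y, y \in net -> n1 <= \sum_i \1_(nball nrm y (h / 2)) (Xs i)].

Hypotheses (good : good_sample) (w0 : 0 <= w).

Let N0 : 0 < N%:R :> R.
Proof. by rewrite ltr0n; apply: leq_trans N2. Qed.

Let e0 : 0 < e. Proof. by rewrite divr_gt0. Qed.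

Lemma good_ball_sum x r : Xset x -> 0 <= r -> r <= h ->
  `|\sum_(i | nrm (tsub (Xs i) x) <= r) Ws i| <= b + w * z.
Proof.
move=> Sx r0 rh; have [y ynet xy] := netP Sx.
have [_ Hw Hb Hz _] := good.
(* The radius is rounded down to the grid; [r <= h = N * e] keeps the index at most [N]. *)
have jN : (Num.trunc (r / e) < N.+1)%N.
  rewrite (truncn_lt_nat _ (divr_ge0 r0 (ltW e0))) ltr_pdivrMr //.
  have Ne : N%:R * e = h by rewrite mulrC divfK // gt_eqF.
  by rewrite -natr1 mulrDl mul1r Ne; have := e0; lra.
pose j : 'I_N.+1 := Ordinal jN.
have /andP[jr rj] : j%:R * e <= r < j%:R * e + e.
  have := truncn_itv (divr_ge0 r0 (ltW e0)).
  by rewrite ler_pdivlMr // ltr_pdivrMr // -natr1 mulrDl mul1r.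
move: {Hb Hz}(Hb y j ynet) (Hz y j ynet).
move: (j%:R * e) jr rj => rho jr rj Hb Hz.
have -> : \sum_(i | nrm (tsub (Xs i) x) <= r) Ws i =
    \sum_i \1_(nball nrm y rho) (Xs i) * Ws i +
    \sum_i (\1_(nball nrm x r) (Xs i) - \1_(nball nrm y rho) (Xs i)) * Ws i.
  rewrite -big_split big_mkcond /=; apply: eq_bigr => i _.
  have xr : (Xs i \in nball nrm x r) = (nrm (tsub (Xs i) x) <= r).
    by apply/idP/idP; rewrite inE.
  by rewrite [\1_(nball nrm x r) _]indicE xr; case: ifP => _ /=; ring.
apply: le_trans (ler_normD _ _) _; apply: lerD => //.
apply: le_trans (ler_norm_sum _ _ _) _.
apply: (@le_trans _ _ (\sum_i w * \1_(annulus nrm y rho e) (Xs i))); last first.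
  by rewrite -mulr_sumr ler_wpM2l.
apply: ler_sum => i _; rewrite normrM mulrC; apply: ler_pM => //.
have t1 := norm_tsub_triangle nn (Xs i) x y.
have t2 := norm_tsub_triangle nn (Xs i) y x; rewrite (norm_tsubC nn y x) in t2.
rewrite !indicE.
have [xi|xi] := pselect (nball nrm x r (Xs i));
  have [yi|yi] := pselect (nball nrm y rho (Xs i)); rewrite ?(mem_set xi)
  ?(mem_set yi) ?(memNset xi) ?(memNset yi) ?subrr ?normr0 //.
- rewrite subr0 normr1 (@mem_set _ (annulus nrm y rho e)) //.
  move: xi yi; rewrite /annulus /nball /= => xi /negP; rewrite -ltNge => yi.
  by split; [lra|apply/negP; rewrite -ltNge; lra].
- rewrite sub0r normrN1 (@mem_set _ (annulus nrm y rho e)) //.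
  move: xi yi; rewrite /annulus /nball /= => /negP; rewrite -ltNge => xi yi.
  by split; [lra|apply/negP; rewrite -ltNge; lra].
Qed.

(** The Huber comparison controls only a distance [tau] of at most [T / 4]. Since the error never
    exceeds [2 * M], the factor [2 + 8 * M / T] turns a bound on [tau] into a bound on the error. *)
Lemma good_sample_error (K eta : d.-tuple R -> R) (L T M cK CK : R) (q : nat)
    (x : d.-tuple R) (Ys : 'I_N -> R) (s : R) :
  (forall u, 1 < nrm u -> K u = 0) ->
  (forall u, nrm u <= 1 -> cK <= K u <= CK) ->
  (forall u v, nrm u <= nrm v -> K v <= K u) ->
  (forall x1 x2, Xset x1 -> Xset x2 -> `|eta x1 - eta x2| <= L * nrm (tsub x1 x2)) ->
  (forall x, Xset x -> `|eta x| <= M) ->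
  0 < L -> 0 < T -> 0 < cK -> cK <= CK -> 0 <= b + w * z -> L * h + w <= T / 2 ->
  0 < n1 -> q%:R <= n1 / 2 ->
  Xset x -> attacked_labels q eta Xs Ws Ys -> is_eta0_hat K h T M Xs Ys x s ->
  `|s - eta x| <= (2 + 8 * M / T) *
    (L * h + 2 * (CK * (b + w * z) + 2 * CK * T * q%:R) / (cK * n1)).
Proof.
move=> K0 Kc Kmon etaL etaM L0 T0 cK0 cCK bwz0 LT n10 qn Sx [bad [badq yE]] [sM smin].
have [XS Hw _ _ Hn] := good; have [n0 _ nZ _] := nn.
have M0 : 0 <= M by apply: le_trans (etaM x Sx).
have CK0 : 0 < CK by exact: lt_le_trans cCK.
have num0 : 0 <= CK * (b + w * z) + 2 * CK * T * q%:R.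
  by rewrite addr_ge0 // !mulr_ge0 // ltW.
pose k i := K (tscale h^-1 (tsub x (Xs i))).
pose r i := nrm (tsub (Xs i) x).
have kr i : nrm (tscale h^-1 (tsub x (Xs i))) = r i / h.
  by rewrite nZ gtr0_norm ?invr_gt0 // (norm_tsubC nn) mulrC.
have k0 i : 0 <= k i <= CK.
  rewrite /k; have [u1|u1] := lerP (nrm (tscale h^-1 (tsub x (Xs i)))) 1.
    by have /andP[? ->] := Kc _ u1; rewrite andbT; lra.
  by rewrite K0 // lexx ltW.
have kn0 i : k i != 0 -> r i <= h.
  move=> ki; rewrite leNgt; apply: contra ki => hr.
  by rewrite /k K0 // kr ltr_pdivlMr // mul1r.
have sumW : `|\sum_i k i * Ws i| <= CK * (b + w * z).
  apply: (@radial_weighted_sum _ _ r) => // [i j ij||j /kn0 rj].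
  - by apply: Kmon; rewrite !kr ler_pM2r ?invr_gt0.
  - exact: ltW.
  - by apply: good_ball_sum => //; exact: n0.
set err := `|s - eta x|.
have err2M : err <= 2 * M.
  by apply: le_trans (ler_normB _ _) _; have := etaM x Sx; lra.
have [->|errN0] := eqVneq err 0.
  apply: mulr_ge0; first by rewrite addr_ge0 // divr_ge0 ?mulr_ge0 // ltW.
  apply: addr_ge0; first by rewrite mulr_ge0 // ltW.
  by rewrite divr_ge0 ?mulr_ge0 // ltW.
have err0 : 0 < err by rewrite lt_neqAle eq_sym errN0 normr_ge0.
(* The halving gives both [tau < err], which needs a nonzero error, and [tau <= T / 4]. *)
pose tau := Num.min err (T / 2) / 2.
have tau_err : tau < err by rewrite /tau; case: (lerP err (T / 2)); lra.
have tau0 : 0 <= tau by rewrite /tau; case: (lerP err (T / 2)); lra.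
have tauT : tau <= T / 4 by rewrite /tau; case: (lerP err (T / 2)); lra.
have main : tau * (\sum_(i | i \notin bad) k i) <=
    L * h * (\sum_(i | i \notin bad) k i) + `|\sum_i k i * Ws i| + 2 * CK * T * q%:R.
  apply: (@huber_minimizer_error _ _ bad k Ys Ws T M s (eta x)) => //.
  - exact: ltW.
  - exact: etaM.
  - by rewrite mulr_ge0 // ltW.
  - move=> i ib ki; rewrite yE // addrK; apply: le_trans (etaL _ _ (XS i) Sx) _.
    by apply: ler_wpM2l; [exact: ltW|exact: kn0].
  - by move=> i ki; apply: le_trans LT; rewrite lerD2l.
(* At least [n1] sample points lie within [h / 2] of a net point [y], hence within [h] of [x]
   because [e <= h / 2]. At most [q <= n1 / 2] of them are attacked, and each other one has weight
   at least [cK]. *)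
have kap : cK * n1 / 2 <= \sum_(i | i \notin bad) k i.
  have [y ynet xy] := netP Sx; have := Hn y ynet.
  rewrite (bigID (mem bad)) /= => h1.
  have h2 : \sum_(i in bad) (\1_(nball nrm y (h / 2)) (Xs i) : R) <= q%:R.
    apply: le_trans (_ : \sum_(i in bad) 1 <= _); last by rewrite sumr_const ler_nat.
    by apply: ler_sum => i _; rewrite indicE; case: (_ \in _).
  have h3 : cK * \sum_(i | i \notin bad) \1_(nball nrm y (h / 2)) (Xs i) <=
      \sum_(i | i \notin bad) k i.
    rewrite mulr_sumr; apply: ler_sum => i _; rewrite indicE.
    have [yi|yi] := pselect (nball nrm y (h / 2) (Xs i)); last first.
      by rewrite (memNset yi) mulr0; have /andP[] := k0 i.
    rewrite (mem_set yi) mulr1.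
    suff /Kc/andP[] : nrm (tscale h^-1 (tsub x (Xs i))) <= 1 by [].
    rewrite kr ler_pdivrMr // mul1r /r.
    apply: le_trans (norm_tsub_triangle nn _ y _) _; rewrite (norm_tsubC nn y).
    have eh : e <= h / 2.
      by rewrite /e ler_pM2l // lef_pV2 ?posrE // ler_nat.
    by move: yi; rewrite /nball /=; lra.
  apply: le_trans h3; rewrite -mulrA ler_pM2l //; lra.
have tau_le : tau <= L * h + 2 * (CK * (b + w * z) + 2 * CK * T * q%:R) / (cK * n1).
  set kp := \sum_(i | i \notin bad) k i in main kap *.
  have cn0 : 0 < cK * n1 by rewrite mulr_gt0.
  rewrite -lerBlDl ler_pdivlMr //.
  have [tl|tl] := lerP (tau - L * h) 0.
    apply: (@le_trans _ _ 0); first by rewrite mulr_le0_ge0 // ltW.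
    by rewrite mulr_ge0.
  have : (tau - L * h) * (cK * n1 / 2) <= (tau - L * h) * kp.
    by rewrite ler_pM2l.
  rewrite mulrBl; lra.
have fac : err <= (2 + 8 * M / T) * tau.
  rewrite /tau; case: (lerP err (T / 2)) => errT.
    have : 0 <= 8 * M / T * (err / 2) by rewrite !mulr_ge0 ?invr_ge0 // ltW.
    lra.
  have -> : (2 + 8 * M / T) * (T / 2 / 2) = T / 2 + 2 * M by field; rewrite gt_eqF.
  lra.
apply: le_trans fac _; apply: ler_wpM2l => //.
by rewrite addr_ge0 // divr_ge0 ?mulr_ge0 // ltW.
Qed.

End good_sample.

(** * Probability of a bad sample *)

Lemma subrXX_le (R : realType) (a b : R) n : 0 <= b -> b <= a ->
  a ^+ n - b ^+ n <= n%:R * a ^+ n.-1 * (a - b).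
Proof.
move=> b0 ba; rewrite subrXX mulrC ler_wpM2r ?subr_ge0 //.
apply: (@le_trans _ _ (\sum_(i < n) a ^+ n.-1)); last first.
  by rewrite sumr_const card_ord -[_ *+ _]mulr_natl.
have a0 : 0 <= a by apply: le_trans ba.
apply: ler_sum => i _; have ni : (i <= n.-1)%N.
  by rewrite -ltnS prednK ?ltn_ord // (leq_trans _ (ltn_ord i)).
rewrite -[in leRHS](subnK ni) exprD ler_wpM2l ?exprn_ge0 //.
by rewrite lerXn2r ?nnegrE.
Qed.

Section ball_probability.
Context (R : realType) (d : nat) (nrm : d.-tuple R -> R)
  (lam : {measure set (d.-tuple R) -> \bar R}) (d0 : measure_display)
  (Omega : measurableType d0) (P : probability Omega R) (X : Omega -> d.-tuple R)
  (f : d.-tuple R -> R) (Xset : set (d.-tuple R)) (fm fM D alpha : R).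
Hypotheses (d_gt0 : (0 < d)%N) (nn : is_norm nrm) (lamE : is_lebesgue lam)
  (mX : measurable_fun setT X) (Xf : has_density P lam X f) (f0 : forall x, 0 <= f x)
  (fm0 : 0 < fm) (fM0 : 0 < fM) (mXset : measurable Xset)
  (f_out : forall x, ~ Xset x -> f x = 0)
  (f_in : forall x, Xset x -> fm <= f x <= fM)
  (thick : forall x r, Xset x -> 0 < r -> r < D ->
     ((alpha * vol_unit_ball nrm lam * r ^+ d)%:E <= lam (nball nrm x r `&` Xset))%E).
Let v := vol_unit_ball nrm lam.

Let fin_pre A : measurable A -> P (X @^-1` A) \is a fin_num.
Proof. by move=> mA; rewrite fin_num_measure // -[Y in measurable Y]setTI; apply: mX. Qed.

Let f_le x : f x <= fM.
Proof.
have [Sx|Sx] := pselect (Xset x); first by have /andP[] := f_in Sx.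
by rewrite f_out // ltW.
Qed.

Lemma ball_probability_ge x r : Xset x -> 0 < r -> r < D ->
  fm * alpha * v * r ^+ d <= fine (P (X @^-1` nball nrm x r)).
Proof.
move=> Sx r0 rD; have mB : measurable (nball nrm x r) by exact: measurable_nball.
rewrite -lee_fin fineK ?fin_pre //.
have := density_ge Xf f0 (ltW fm0) mB mXset (fun x Sx => proj1 (andP (f_in Sx))).
apply: le_trans; rewrite -!mulrA EFinM; apply: lee_wpmul2l; first by rewrite lee_fin ltW.
by rewrite !mulrA; exact: thick.
Qed.

Lemma ball_probability_le x r : 0 < r ->
  fine (P (X @^-1` nball nrm x r)) <= fM * v * r ^+ d.
Proof.
move=> r0; have mB : measurable (nball nrm x r) by exact: measurable_nball.
rewrite -lee_fin fineK ?fin_pre //.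
apply: le_trans (density_le Xf f0 mB f_le) _.
have [_ ->] := lebesgue_nball nn lamE => //.
by rewrite -EFinM lee_fin mulrA.
Qed.

Lemma measurable_annulus x r e : measurable (annulus nrm x r e).
Proof. by apply: measurableD; exact: measurable_nball. Qed.

(** The volume is a difference of [d]-th powers of radii that are [3 * e] apart and at most
    [2 * h]. *)
Lemma annulus_probability_le x r e h : 0 <= r -> r <= h -> 0 < e -> 2 * e <= h ->
  fine (P (X @^-1` annulus nrm x r e)) <= fM * v * (3 * d%:R * (2 * h) ^+ d.-1 * e).
Proof.
move=> r0 rh e0 eh; have mA := measurable_annulus x r e.
rewrite -lee_fin fineK ?fin_pre //.
apply: le_trans (density_le Xf f0 mA f_le) _.
have [v0 ball] := lebesgue_nball nn lamE.
rewrite -mulrA EFinM; apply: lee_wpmul2l; first by rewrite lee_fin ltW.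
have mB s : measurable (nball nrm x s) by exact: measurable_nball.
have re0 : 0 < r + 2 * e by lra.
(* The volume formula covers positive radii only. If the inner radius is not positive, the whole
   outer ball is used: its radius is at most [3 * e], and [1 <= d] absorbs the difference. *)
have [re|re] := lerP (r - e) 0.
  apply: (@le_trans _ _ (lam (nball nrm x (r + 2 * e)))).
    by apply: le_measure; rewrite ?inE // => y [].
  rewrite ball // lee_fin ler_pM2l //.
  rewrite -[in leLHS](prednK d_gt0) exprSr.
  have d1 : 1 <= d%:R :> R by rewrite ler1n.
  apply: (@le_trans _ _ ((2 * h) ^+ d.-1 * (3 * e))).
    apply: ler_pM; [apply: exprn_ge0; lra|lra| |lra].
    by rewrite lerXn2r ?nnegrE; lra.
  have : 0 <= (2 * h) ^+ d.-1 * (3 * e).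
    by apply: mulr_ge0; [apply: exprn_ge0; lra|lra].
  have -> : 3 * d%:R * (2 * h) ^+ d.-1 * e = d%:R * ((2 * h) ^+ d.-1 * (3 * e)) by ring.
  by move=> t0; exact: ler_peMl.
have finB : (lam (nball nrm x (r + 2 * e)) < +oo)%E by rewrite ball // ltry.
rewrite (measureD (mB _) (mB _) finB).
rewrite (_ : _ `&` _ = nball nrm x (r - e)); last first.
  by apply/seteqP; split => [y [] //|y]; rewrite /nball /= => yr; split => //=; lra.
rewrite -[leLHS]/(lam (nball nrm x (r + 2 * e)) - lam (nball nrm x (r - e)))%E.
rewrite !ball // -EFinB lee_fin -mulrBr ler_pM2l //.
apply: le_trans (subrXX_le _ _ _) _; try lra.
have -> : r + 2 * e - (r - e) = 3 * e by ring.
apply: (@le_trans _ _ (d%:R * (2 * h) ^+ d.-1 * (3 * e))); last by lra.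
rewrite ler_pM2r; last by lra.
by rewrite ler_pM2l ?ltr0n // lerXn2r ?nnegrE; lra.
Qed.

End ball_probability.

Lemma integral_probability_cst (R : realType) d0 (Omega : measurableType d0)
    (P : probability Omega R) (c : R) : (\int[P]_w c%:E = c%:E)%E.
Proof.
rewrite -[LHS]/(\int[P]_w (cst c%:E w))%E integral_cst //.
by rewrite [X in (_ * X)%E]probability_setT mule1.
Qed.

Lemma union_bound (R : realType) d0 (Omega : measurableType d0) (P : probability Omega R)
    (I : eqType) (s : seq I) (F : I -> set Omega) (c : R) :
  (forall i, i \in s -> measurable (F i) /\ (P (F i) <= c%:E)%E) ->
  measurable (\big[setU/set0]_(i <- s) F i) /\
  (P (\big[setU/set0]_(i <- s) F i) <= ((size s)%:R * c)%:E)%E.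
Proof.
elim: s => [|i s IH] H; first by rewrite big_nil measure0 mul0r.
have [mi Pi] := H i (mem_head _ _).
have [|ms Ps] := IH; first by move=> j js; apply: H; rewrite inE js orbT.
rewrite big_cons; split; first exact: measurableU.
apply: le_trans (measureU2 P mi ms) _; rewrite /= -natr1 mulrDl mul1r addrC EFinD.
exact: leeD.
Qed.

Lemma expR_le_1D2x (R : realType) (x : R) : 0 <= x -> x <= 1 / 2 -> expR x - 1 <= 2 * x.
Proof.
move=> x0 x1; have := expR_ge1Dx (- x); rewrite expRN => h.
have : (expR x)^-1 * expR x = 1 by rewrite mulVf // gt_eqF ?expR_gt0.
have : 0 < expR x := expR_gt0 x.
by move: h; move: (expR x) (expR x)^-1 => u t ? ? ?; nra.
Qed.

Definition thinned_superlevel (R : realType) d (Omega : Type) N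
    (X : 'I_N -> Omega -> d.-tuple R) (W : 'I_N -> Omega -> R)
    (B : set (d.-tuple R)) (phi : R -> R) (a : R) :=
  [set w | a <= \sum_i \1_B (X i w) * phi (W i w)].

Section sampling.
Context (R : realType) (d : nat) (nrm : d.-tuple R -> R)
  (lam : {measure set (d.-tuple R) -> \bar R}) (d0 : measure_display)
  (Omega : measurableType d0) (P : probability Omega R) (N : nat)
  (X : 'I_N -> Omega -> d.-tuple R) (W : 'I_N -> Omega -> R)
  (f : d.-tuple R -> R) (Xset : set (d.-tuple R)) (fm fM D alpha sigma h : R).
Hypotheses (d_gt0 : (0 < d)%N) (nn : is_norm nrm) (lamE : is_lebesgue lam)
  (mX : forall i, measurable_fun setT (X i)) (mW : forall i, measurable_fun setT (W i))
  (indep : mutually_independent P X W)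
  (Xf : forall i, has_density P lam (X i) f) (f0 : forall x, 0 <= f x)
  (fm0 : 0 < fm) (fM0 : 0 < fM) (D0 : 0 < D) (alpha0 : 0 < alpha) (sigma0 : 0 < sigma)
  (mXset : measurable Xset)
  (f_out : forall x, ~ Xset x -> f x = 0)
  (f_in : forall x, Xset x -> fm <= f x <= fM)
  (thick : forall x r, Xset x -> 0 < r -> r < D ->
     ((alpha * vol_unit_ball nrm lam * r ^+ d)%:E <= lam (nball nrm x r `&` Xset))%E)
  (W_mgf : forall i (lmb : R), `|lmb| <= sigma^-1 ->
     (\int[P]_w (expR (lmb * W i w))%:E <= (expR (sigma ^+ 2 * lmb ^+ 2 / 2))%:E)%E)
  (N2 : (2 <= N)%N) (h0 : 0 < h) (hD : h < D) (Nh : 1 <= N%:R * h ^+ d).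

Let v := vol_unit_ball nrm lam.
Let e := h / N%:R.
Let g := Num.sqrt (N%:R * h ^+ d).
(** A ball of radius [h / 2] about a point of [Xset] has probability at least [p0 * h ^+ d]; [n1] is
    a quarter of the resulting lower bound on the expected count. *)
Let p0 := fm * alpha * v / 2 ^+ d.
Let n1 := p0 / 4 * (N%:R * h ^+ d).
(** The exponent [d + 3] pays for [O(N ^ (d + 1))] net points and [N + 1] radii, and still leaves
    [O(1 / N)]. *)
Let z : R := (d + 3)%:R * ln N%:R.
Let delta : R := (N%:R ^+ (d + 3))^-1.

Let N0 : 0 < N%:R :> R.
Proof. by rewrite ltr0n; apply: leq_trans N2. Qed.

Let e0 : 0 < e. Proof. by rewrite divr_gt0. Qed.

Let e_le : 2 * e <= h.
Proof.
have : e <= h / 2 by rewrite /e ler_pM2l // lef_pV2 ?posrE // ler_nat.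
lra.
Qed.

Let v0 : 0 < v. Proof. by have [] := lebesgue_nball nn lamE. Qed.

Let p00 : 0 < p0. Proof. by rewrite divr_gt0 ?exprn_gt0 // !mulr_gt0. Qed.

Let g1 : 1 <= g. Proof. by rewrite -[1]sqrtr1 ler_sqrt // (le_trans ler01). Qed.

Let gg : g ^+ 2 = N%:R * h ^+ d.
Proof. by rewrite sqr_sqrtr // (le_trans ler01). Qed.

Let deltaE : expR (- z) = delta.
Proof. by rewrite expRN /z expRM_natl lnK ?posrE. Qed.

Let W_mgf_fin i (lmb : R) : `|lmb| <= sigma^-1 ->
  exists2 m, (\int[P]_w (expR (lmb * W i w))%:E = m%:E)%E &
    m <= expR (sigma ^+ 2 * lmb ^+ 2 / 2).
Proof.
move=> /(W_mgf i) I.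
have I0 : (0 <= \int[P]_w (expR (lmb * W i w))%:E)%E.
  by apply: integral_ge0 => w _; rewrite lee_fin expR_ge0.
have If : (\int[P]_w (expR (lmb * W i w))%:E)%E \is a fin_num.
  by rewrite ge0_fin_numE // (le_lt_trans I) // ltry.
by exists (fine (\int[P]_w (expR (lmb * W i w))%:E)); rewrite -?lee_fin fineK.
Qed.

(** With [lmb] of size [1 / (sigma * g)], which is admissible as [1 <= g], each excess moment is at
    most [1 / g ^ 2]. Over the [N] points, each in the ball with probability at most
    [fM * v * h ^ d], the exponent stays below [fM * v]. *)
Lemma noise_sum_tail (y : d.-tuple R) (r lmb : R) : r <= h ->
  `|lmb| = (sigma * g)^-1 ->
  (P (thinned_superlevel X W (nball nrm y r) ( *%R lmb) z) <=
    (expR (fM * v) * delta)%:E)%E.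
Proof.
move=> rh lmbE; have g0 : 0 < g by apply: lt_le_trans g1.
have lmb_le : `|lmb| <= sigma^-1.
  by rewrite lmbE lef_pV2 ?posrE ?mulr_gt0 // ler_peMr // ltW.
have [m mE m_le] := fin_all_exists2 (fun i => W_mgf_fin i lmb_le).
have lmb2 : sigma ^+ 2 * lmb ^+ 2 / 2 = (g ^+ 2)^-1 / 2.
  rewrite -(real_normK (num_real lmb)) lmbE; field.
  by rewrite !gt_eqF.
have m1 i : m i - 1 <= (g ^+ 2)^-1.
  have g21 : (g ^+ 2)^-1 <= 1 by rewrite invf_le1 ?exprn_gt0 // expr_ge1 // ltW.
  have g20 : 0 < (g ^+ 2)^-1 by rewrite invr_gt0 exprn_gt0.
  have := m_le i; rewrite lmb2.
  by have := @expR_le_1D2x R ((g ^+ 2)^-1 / 2); lra.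
have := @chernoff_thinned_sum _ _ _ _ P N X W mX mW indep (nball nrm y r) ( *%R lmb) m
  (fM * v / N%:R) z (measurable_nball nn y r).
rewrite -deltaE -expRD.
have -> : N%:R * (fM * v / N%:R) - z = fM * v - z by field; rewrite gt_eqF.
apply => // i.
have mB s : measurable (X i @^-1` nball nrm y s).
  by rewrite -[Y in measurable Y]setTI; apply: mX => //; exact: measurable_nball.
apply: (@le_trans _ _ (fine (P (X i @^-1` nball nrm y r)) * (g ^+ 2)^-1)).
  by apply: ler_wpM2l => //; exact: fine_ge0.
have : fine (P (X i @^-1` nball nrm y r)) <= fM * v * h ^+ d.
  apply: le_trans (ball_probability_le nn lamE (mX i) (Xf i) f0 fM0 f_out f_in y h0).
  apply: fine_le; rewrite ?fin_num_measure //; apply: le_measure; rewrite ?inE //.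
  by move=> u; rewrite /nball /= => /le_trans; apply.
move=> H; have gV0 : 0 <= (g ^+ 2)^-1 by rewrite invr_ge0 exprn_ge0 // ltW.
apply: le_trans (ler_wpM2r gV0 H) _; rewrite gg.
have hd0 : 0 < h ^+ d by rewrite exprn_gt0.
by rewrite [leLHS](_ : _ = fM * v / N%:R) //; field; rewrite !gt_eqF.
Qed.

(** The expected count is bounded independently of [N], because the width [h / N] cancels the sample
    size and [h < D]. The exponential moment at parameter one is therefore a constant. *)
Lemma annulus_count_tail (y : d.-tuple R) (r : R) : 0 <= r -> r <= h ->
  (P (thinned_superlevel X W (annulus nrm y r e) (cst 1%R) z) <=
    (expR ((expR 1 - 1) * (fM * v * (3 * d%:R * (2 * D) ^+ d.-1 * D))) * delta)%:E)%E.
Proof.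
move=> r0 rh; set c := expR _ - 1.
have c0 : 0 <= c by have := expR_ge1Dx (1 : R); rewrite /c; lra.
pose t := fM * v * (3 * d%:R * (2 * h) ^+ d.-1 * e).
have Nt : N%:R * (c * t) <= c * (fM * v * (3 * d%:R * (2 * D) ^+ d.-1 * D)).
  have -> : N%:R * (c * t) = c * (fM * v * (3 * d%:R * (2 * h) ^+ d.-1 * h)).
    by rewrite /t /e; field; rewrite gt_eqF.
  apply: ler_wpM2l => //; apply: ler_wpM2l; first by rewrite mulr_ge0 // ltW.
  rewrite -!mulrA; apply: ler_wpM2l => //; apply: ler_wpM2l => //.
  apply: ler_pM; [apply: exprn_ge0; lra|lra| |exact: ltW].
  by rewrite lerXn2r ?nnegrE; have := h0; have := hD; lra.
have := @chernoff_thinned_sum _ _ _ _ P N X W mX mW indep (annulus nrm y r e) (cst 1%R)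
  (fun=> expR 1) (c * t) z (measurable_annulus nn y r e) (measurable_cst _)
  (fun i => integral_probability_cst P (expR 1)).
move=> H; apply: le_trans (H _) _.
- move=> i; rewrite mulrC ler_wpM2l //.
  exact: (annulus_probability_le d_gt0 nn lamE (mX i) (Xf i) f0 fM0 f_out f_in).
- by rewrite -deltaE -expRD lee_fin ler_expR lerD2r.
Qed.

(** A lower tail, written as an upper tail of minus the count. The mean is at least [4 * n1] and
    [expR (- 1) - 1 <= - 1 / 2], so the exponent is at most [- 2 * n1 + n1 = - n1 <= - z]. *)
Lemma ball_count_tail (y : d.-tuple R) : Xset y -> z <= n1 ->
  (P (thinned_superlevel X W (nball nrm y (h / 2)%R) (cst (- 1)%R) (- n1)%R) <= delta%:E)%E.
Proof.
move=> Sy zn1.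
have := @chernoff_thinned_sum _ _ _ _ P N X W mX mW indep (nball nrm y (h / 2)) (cst (- 1))
  (fun=> expR (- 1)) (- (p0 * h ^+ d / 2)) (- n1) (measurable_nball nn y _) (measurable_cst _)
  (fun i => integral_probability_cst P (expR (- 1))).
move=> H; apply: le_trans (H _) _.
- move=> i.
  have h20 : 0 < h / 2 by rewrite divr_gt0.
  have h2D : h / 2 < D by have := h0; have := hD; lra.
  have := ball_probability_ge nn (mX i) (Xf i) f0 fm0 mXset f_in thick Sy h20 h2D.
  have -> : fm * alpha * vol_unit_ball nrm lam * (h / 2) ^+ d = p0 * h ^+ d.
    by rewrite /p0 /v expr_div_n mulrA mulrAC.
  have e1 : expR (- 1) <= 1 / 2 :> R.
    rewrite expRN div1r lef_pV2 ?posrE ?expR_gt0 //.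
    by have := expR_ge1Dx (1 : R); lra.
  by have ph0 : 0 <= p0 * h ^+ d by [rewrite mulr_ge0 ?exprn_ge0 // ltW]; nra.
- rewrite -deltaE lee_fin ler_expR /n1; move: zn1; rewrite /n1; lra.
Qed.

(** The threshold matches (H2), which leaves [8 * sigma * ln N] for the noise inside [T / 2]. Of the
    decay [N ^ -8] only [N ^ -2] is kept, enough for a union over [N] indices. *)
Lemma noise_tail i (lmb : R) : `|lmb| = sigma^-1 ->
  measurable [set w | 8 * ln N%:R <= lmb * W i w] /\
  (P [set w | (8 * ln N%:R <= lmb * W i w)%R] <= (expR (1 / 2) / N%:R ^+ 2)%:E)%E.
Proof.
move=> lmbE; have mlW : measurable_fun setT (fun w => lmb * W i w).
  exact: measurable_funM.
split; first exact: measurable_superlevel.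
have I : (\int[P]_w (expR (lmb * W i w))%:E <= (expR (1 / 2))%:E)%E.
  have := W_mgf i; move=> /(_ lmb); rewrite lmbE lexx => /(_ isT).
  rewrite -(real_normK (num_real lmb)) lmbE.
  by have -> : sigma ^+ 2 * sigma^-1 ^+ 2 / 2 = 1 / 2 by field; rewrite gt_eqF.
apply: le_trans (exp_markov _ mlW I) _; rewrite lee_fin ler_pM2l ?expR_gt0 //.
have -> : (N%:R ^+ 2)^-1 = expR (- (2 * ln N%:R)) :> R.
  by rewrite expRN -[2]/(2%:R) expRM_natl lnK ?posrE.
have : 0 <= ln N%:R :> R by rewrite ln_ge0 // ler1n (leq_trans _ N2).
by rewrite ler_expR; lra.
Qed.

Lemma measurable_thinned_superlevel (B : set (d.-tuple R)) (phi : R -> R) (a : R) :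
  measurable B -> measurable_fun setT phi ->
  measurable (thinned_superlevel X W B phi a).
Proof.
move=> mB mphi; apply: measurable_superlevel; apply: measurable_sum => i.
apply: measurable_funM; first exact: measurable_fun_indicX.
exact: (measurableT_comp mphi (mW i)).
Qed.

(** The first summand pays for single noise values. The second pays, per net point, for one ball
    count and for two noise tails and one annulus count at each radius; [1 / p0] comes from the size
    of the net. *)
Definition failure_const : R := 2 * expR (1 / 2) +
  (1 + 2 * (2 * expR (fM * v) +
    expR ((expR 1 - 1) * (fM * v * (3 * d%:R * (2 * D) ^+ d.-1 * D))))) / p0.

(** Balls of radius [e / 2] have probability at least [p0 * h ^ d / N ^ d], and [1 <= N * h ^ d]
    makes this at least [p0 / N ^ (d + 1)]. *)
Lemma net_exists : exists net : seq (d.-tuple R),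
  [/\ (forall y, y \in net -> Xset y),
    (size net)%:R * p0 <= N%:R ^+ d.+1 &
    forall x, Xset x -> exists2 y, y \in net & nrm (tsub x y) <= e].
Proof.
have i0 : 'I_N by exists 0%N; apply: leq_trans N2.
have pe0 : 0 < p0 * e ^+ d by rewrite mulr_gt0 ?exprn_gt0.
have [|net [netS netn netP]] := @finite_net _ _ nrm _ _ P (X i0) nn (mX i0) Xset e _ pe0 (ltW e0).
  move=> x Sx; have e20 : 0 < e / 2 by rewrite divr_gt0.
  have e2D : e / 2 < D by have := e0; have := e_le; have := hD; lra.
  have := ball_probability_ge nn (mX i0) (Xf i0) f0 fm0 mXset f_in thick Sx e20 e2D.
  by rewrite /p0 /v expr_div_n mulrA mulrAC.
exists net; split => //.
have hd0 : 0 < h ^+ d by rewrite exprn_gt0.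
move: netn; rewrite /e expr_div_n mulrA mulrA ler_pdivrMr ?exprn_gt0 // mul1r => netn.
rewrite exprS; apply: (@le_trans _ _ ((size net)%:R * p0 * (N%:R * h ^+ d))).
  by apply: ler_peMr => //; rewrite mulr_ge0 // ltW.
by rewrite mulrCA ler_pM2l.
Qed.

Lemma good_sample_probability : z <= n1 ->
  exists (net : seq (d.-tuple R)) (Bad : set Omega),
  [/\ (forall x, Xset x -> exists2 y, y \in net & nrm (tsub x y) <= e),
    measurable Bad, (P Bad <= (failure_const / N%:R)%:E)%E &
    forall w, ~ Bad w -> good_sample nrm net Xset (fun i => X i w) (fun i => W i w)
      h (8 * sigma * ln N%:R) (sigma * g * z) z n1].
Proof.
move=> zn1; have [net [netS netn netP]] := net_exists.
have g0 : 0 < g by apply: lt_le_trans g1.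
pose lp := (sigma * g)^-1.
have lp0 : 0 < lp by rewrite invr_gt0 mulr_gt0.
(* The exceptional events: a point outside the support (null), a large noise value, and, per net
   point, a large noise sum of either sign, a crowded annulus at some radius, or a sparse
   half-radius ball. *)
pose B0 i := X i @^-1` (~` Xset).
pose Bw i := [set w | 8 * ln N%:R <= sigma^-1 * W i w] `|`
             [set w | 8 * ln N%:R <= - sigma^-1 * W i w].
pose Bj y (j : 'I_N.+1) :=
  thinned_superlevel X W (nball nrm y (j%:R * e)) ( *%R lp) z `|`
  thinned_superlevel X W (nball nrm y (j%:R * e)) ( *%R (- lp)) z `|`
  thinned_superlevel X W (annulus nrm y (j%:R * e) e) (cst 1) z.
pose By y := thinned_superlevel X W (nball nrm y (h / 2)) (cst (- 1)) (- n1) `|`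
  \big[setU/set0]_(j <- enum 'I_N.+1) Bj y j.
pose E1 := expR (fM * v).
pose E2 := expR ((expR 1 - 1) * (fM * v * (3 * d%:R * (2 * D) ^+ d.-1 * D))).
have je (j : 'I_N.+1) : 0 <= j%:R * e <= h.
  rewrite mulr_ge0 ?(ltW e0) //= mulrC /e mulrAC ler_pdivrMr // ler_pM2l //.
  by rewrite ler_nat -ltnS.
have HB0 i : i \in enum 'I_N -> measurable (B0 i) /\ (P (B0 i) <= 0%:E)%E.
  move=> _; split; last by rewrite (density_support (Xf i)).
  by rewrite -[Y in measurable Y]setTI; apply: mX => //; exact: measurableC.
have HBw i : i \in enum 'I_N ->
    measurable (Bw i) /\ (P (Bw i) <= (2 * expR (1 / 2) / N%:R ^+ 2)%:E)%E.
  move=> _; have sV : `|sigma^-1| = sigma^-1 by rewrite gtr0_norm ?invr_gt0.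
  have [m1 P1] := noise_tail i sV.
  have [|m2 P2] := @noise_tail i (- sigma^-1); first by rewrite normrN.
  split; first exact: measurableU.
  apply: le_trans (measureU2 P m1 m2) _; apply: le_trans (leeD P1 P2) _.
  by rewrite -EFinD lee_fin -mulrA mulr_natl mulr2n.
have HBj y j : j \in enum 'I_N.+1 ->
    measurable (Bj y j) /\ (P (Bj y j) <= ((2 * E1 + E2) * delta)%:E)%E.
  move=> _; have /andP[j0 jh] := je j.
  have m1 : measurable (thinned_superlevel X W (nball nrm y (j%:R * e)) ( *%R lp) z).
    by apply: measurable_thinned_superlevel; [exact: measurable_nball|exact: measurable_funM].
  have m2 : measurable (thinned_superlevel X W (nball nrm y (j%:R * e)) ( *%R (- lp)) z).
    by apply: measurable_thinned_superlevel; [exact: measurable_nball|exact: measurable_funM].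
  have m3 : measurable (thinned_superlevel X W (annulus nrm y (j%:R * e) e) (cst 1) z).
    by apply: measurable_thinned_superlevel => //; exact: measurable_annulus.
  split; first by apply: measurableU => //; exact: measurableU.
  apply: le_trans (measureU2 P (measurableU _ _ m1 m2) m3) _.
  rewrite mulrDl EFinD; apply: leeD; last exact: annulus_count_tail.
  apply: le_trans (measureU2 P m1 m2) _.
  have -> : 2 * E1 * delta = E1 * delta + E1 * delta by ring.
  rewrite EFinD.
  by apply: leeD; apply: noise_sum_tail; rewrite ?normrN ?gtr0_norm.
have HBy y : y \in net -> measurable (By y) /\
    (P (By y) <= (delta + (N.+1)%:R * ((2 * E1 + E2) * delta))%:E)%E.
  move=> ynet; have [mj Pj] := union_bound (HBj y); rewrite size_enum_ord in Pj.
  have mb : measurable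
      (thinned_superlevel X W (nball nrm y (h / 2)) (cst (- 1)) (- n1)).
    by apply: measurable_thinned_superlevel => //; exact: measurable_nball.
  split; first exact: measurableU.
  apply: le_trans (measureU2 P mb mj) _; rewrite EFinD; apply: leeD => //.
  by apply: ball_count_tail => //; exact: netS.
have [m0 P0] := union_bound HB0; have [mw Pw] := union_bound HBw.
have [my Py] := union_bound HBy.
rewrite mulr0 in P0; rewrite size_enum_ord in Pw.
exists net, (\big[setU/set0]_(i <- enum 'I_N) B0 i `|`
  \big[setU/set0]_(i <- enum 'I_N) Bw i `|` \big[setU/set0]_(y <- net) By y).
split => //.
- by apply: measurableU => //; exact: measurableU.
- apply: le_trans (measureU2 P (measurableU _ _ m0 mw) my) _.
  apply: le_trans (leeD (measureU2 P m0 mw) (lexx _)) _.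
  apply: le_trans (leeD (leeD P0 Pw) Py) _.
  rewrite add0e -EFinD lee_fin /failure_const [leRHS]mulrDl -/E1 -/E2.
  apply: lerD.
    by rewrite le_eqVlt; apply/orP; left; apply/eqP; field; rewrite gt_eqF.
  have E0 : 0 <= 2 * E1 + E2 by rewrite addr_ge0 ?mulr_ge0 ?expR_ge0.
  have dl0 : 0 < delta by rewrite invr_gt0 exprn_gt0.
  have N1 : 1 <= N%:R :> R by rewrite ler1n (leq_trans _ N2).
  (* The [N + 1] radii are at most [2 * N]; the net size [N ^ (d + 1) / p0] times [N * delta] then
     leaves a multiple of [1 / N]. *)
  apply: (@le_trans _ _ ((size net)%:R * (N%:R * (1 + 2 * (2 * E1 + E2)) * delta))).
    apply: ler_wpM2l => //; rewrite -subr_ge0 -(natr1 N).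
    set E := 2 * E1 + E2 in E0 *.
    have -> : N%:R * (1 + 2 * E) * delta - (delta + (N%:R + 1) * (E * delta)) =
        delta * ((N%:R - 1) * (1 + E)) by ring.
    by apply: mulr_ge0; [exact: ltW|apply: mulr_ge0; lra].
  apply: (@le_trans _ _ (N%:R ^+ d.+1 / p0 * (N%:R * (1 + 2 * (2 * E1 + E2)) * delta))).
    apply: ler_wpM2r; last by rewrite ler_pdivlMr.
    apply: mulr_ge0; last exact: ltW.
    by apply: mulr_ge0; [exact: ltW|have := E0; lra].
  have -> : N%:R ^+ d.+1 / p0 * (N%:R * (1 + 2 * (2 * E1 + E2)) * delta) =
      (1 + 2 * (2 * E1 + E2)) / p0 * (N%:R ^+ d.+2 * delta) by rewrite [N%:R ^+ d.+2]exprSr; ring.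
  rewrite le_eqVlt; apply/orP; left; apply/eqP; congr (_ * _).
  have -> : delta = N%:R^-1 * (N%:R ^+ d.+2)^-1 by rewrite /delta addn3 exprS invfM.
  by rewrite mulrCA mulfV ?mulr1 // expf_neq0 // gt_eqF.
move=> w nB.
have {nB}[nB0 nBw nBy] : [/\ forall i, ~ B0 i w, forall i, ~ Bw i w &
    forall y, y \in net -> ~ By y w].
  split=> [i Bi|i Bi|y ynet Bi]; apply: nB.
  - by left; left; rewrite -bigcup_seq; exists i => //=; rewrite mem_enum.
  - by left; right; rewrite -bigcup_seq; exists i => //=; rewrite mem_enum.
  - by right; rewrite -bigcup_seq; exists y.
have nBj y j : y \in net -> ~ Bj y j w.
  move=> ynet Bi; apply: (nBy y ynet); right; rewrite -bigcup_seq; exists j => //=.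
  by rewrite mem_enum.
split.
- by move=> i; apply: contrapT; exact: nB0.
- move=> i; rewrite leNgt; apply/negP => Wi; apply: (nBw i).
  have [W0|W0] := lerP 0 (W i w).
    left; rewrite /= ler_pdivlMl // mulrCA mulrA.
    by move: Wi; rewrite ger0_norm // => /ltW.
  right; rewrite /= mulNr -mulrN ler_pdivlMl // mulrCA mulrA.
  by move: Wi; rewrite ltr0_norm // => /ltW.
- move=> y j ynet; rewrite leNgt; apply/negP => Sw; apply: (nBj y j ynet).
  set s := \sum_i _ in Sw.
  have sE c : \sum_i \1_(nball nrm y (j%:R * e)) (X i w) * (c * W i w) = c * s.
    by rewrite mulr_sumr; apply: eq_bigr => i _; ring.
  left; have [s0|s0] := lerP 0 s.
    left; rewrite /thinned_superlevel /= sE ler_pdivlMl ?mulr_gt0 //.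
    by move: Sw; rewrite ger0_norm // => /ltW.
  right; rewrite /thinned_superlevel /= sE mulNr -mulrN ler_pdivlMl ?mulr_gt0 //.
  by move: Sw; rewrite ltr0_norm // => /ltW.
- move=> y j ynet; rewrite leNgt; apply/negP => Sw; apply: (nBj y j ynet).
  right; rewrite /thinned_superlevel /=; apply: le_trans (ltW Sw) _.
  by apply: ler_sum => i _; rewrite mulr1.
- move=> y ynet; rewrite leNgt; apply/negP => Sw; apply: (nBy y ynet).
  left; rewrite /thinned_superlevel /= -mulr_suml mulrN1 lerN2; exact: ltW.
Qed.

End sampling.

(** * The error bound *)

Lemma worst_error_le (R : realType) d (N q : nat) (K : d.-tuple R -> R) (h T M c : R)
    (Xset : set (d.-tuple R)) (eta : d.-tuple R -> R) (Xs : 'I_N -> d.-tuple R)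
    (Ws : 'I_N -> R) :
  (forall x Ys s, Xset x -> attacked_labels q eta Xs Ws Ys ->
     is_eta0_hat K h T M Xs Ys x s -> `|s - eta x| <= c) ->
  (worst_error q K h T M Xset eta Xs Ws <= c%:E)%E.
Proof.
move=> H; apply: ge_ereal_sup => _ [x [Ys [s [Sx Y S ->]]]].
by rewrite lee_fin; exact: (H _ _ _ Sx Y S).
Qed.

Lemma integral_indicD_cst (R : realType) d0 (Omega : measurableType d0)
    (P : probability Omega R) (A : set Omega) (a c : R) :
  measurable A -> 0 <= a -> 0 <= c ->
  (\int[P]_w (a * \1_A w + c)%:E = a%:E * P A + c%:E)%E.
Proof.
move=> mA a0 c0.
have mI : measurable_fun setT (fun w => (\1_A w : R)%:E).
  by apply/measurable_EFinP; exact: measurable_indic.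
transitivity (\int[P]_w (a%:E * (\1_A w)%:E + c%:E))%E.
  by apply: eq_integral => w _; rewrite EFinD EFinM.
rewrite ge0_integralD //.
- rewrite integral_probability_cst ge0_integralZl_EFin //.
  by rewrite integral_indic // setIT.
- by move=> w _; rewrite mule_ge0 // lee_fin.
- exact: measurable_funeM.
Qed.

Ltac nonneg := solve [repeat first [by [] | exact: ltW | apply: addr_ge0 |
  apply: divr_ge0 | apply: mulr_ge0 | apply: exprn_ge0]].

Section error_constants.
Context (R : realType) (d : nat) (L sigma M cK CK p0 : R).
Hypotheses (L0 : 0 < L) (sigma0 : 0 < sigma) (M0 : 0 < M) (cK0 : 0 < cK) (cCK : cK <= CK)
  (p00 : 0 < p0).

(** The first factor uses [16 * sigma * ln 2 <= T]. In the second, [72 = 2 * 4 * 9], where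
    [9 = 1 + 8] merges the noise sum with the discretisation error, and [16 = 2 * 2 * 4] belongs to
    the attack term. *)
Definition main_const := (2 + 8 * M / (16 * sigma * ln 2)) *
  (L + 72 * CK * sigma * (d + 3)%:R / (cK * p0) + 16 * CK / (cK * p0)).

Lemma main_const_ge0 : 0 <= main_const.
Proof.
have CK0 : 0 < CK by exact: lt_le_trans cCK.
have l20 : 0 < ln 2 :> R by rewrite ln_gt0 // ltr1n.
apply: mulr_ge0.
  nonneg.
nonneg.
Qed.

(** The discretisation error is of order [lN ^ 2] and the noise sum of order [g * lN]; [lN <= g]
    absorbs the former. Division by [G = g ^ 2] then gives the rate [lN / g]. *)
Lemma main_const_bound (T h G g lN q : R) :
  16 * sigma * ln 2 <= T -> 0 < h -> 0 < g -> G = g ^+ 2 -> 0 <= lN -> lN <= g -> 0 <= q ->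
  (2 + 8 * M / T) * (L * h + 2 * (CK * (sigma * g * ((d + 3)%:R * lN) +
      8 * sigma * lN * ((d + 3)%:R * lN)) + 2 * CK * T * q) / (cK * (p0 / 4 * G)))
  <= main_const * (T * q / G + h + lN / g).
Proof.
move=> TT h0 g0 -> lN0 lNg q0.
have CK0 : 0 < CK by exact: lt_le_trans cCK.
have l20 : 0 < ln 2 :> R by rewrite ln_gt0 // ltr1n.
have T00 : 0 < 16 * sigma * ln 2 by rewrite !mulr_gt0.
have T0 : 0 < T by exact: lt_le_trans TT.
rewrite /main_const -[leRHS]mulrA.
have F0 : 0 <= 2 + 8 * M / T by nonneg.
set a1 := T * q / g ^+ 2; set a3 := lN / g.
have a10 : 0 <= a1 by nonneg.
have a30 : 0 <= a3 by nonneg.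
set B1 := 72 * CK * sigma * (d + 3)%:R / (cK * p0); set B2 := 16 * CK / (cK * p0).
have B10 : 0 <= B1 by nonneg.
have B20 : 0 <= B2 by nonneg.
apply: ler_pM => //.
- nonneg.
- rewrite lerD2l; apply: ler_wpM2l; first by rewrite mulr_ge0 // ltW.
  by rewrite lef_pV2 ?posrE.
apply: (@le_trans _ _ (L * h + B1 * a3 + B2 * a1)); last first.
  have := mulr_ge0 (ltW L0) a10; have := mulr_ge0 (ltW L0) a30.
  have := mulr_ge0 B10 (ltW h0); have := mulr_ge0 B20 (ltW h0).
  have := mulr_ge0 B10 a10; have := mulr_ge0 B20 a30; nra.
rewrite -addrA lerD2l.
have -> : B1 * a3 + B2 * a1 =
    2 * (CK * (9 * sigma * (d + 3)%:R * lN * g) + 2 * CK * T * q) / (cK * (p0 / 4 * g ^+ 2)).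
  by rewrite /B1 /B2 /a1 /a3; field; rewrite !gt_eqF.
apply: ler_wpM2r; first by rewrite invr_ge0; nonneg.
rewrite ler_pM2l // lerD2r ler_pM2l //.
have : 0 <= 8 * sigma * (d + 3)%:R * lN * (g - lN).
  by apply: mulr_ge0; [nonneg|rewrite subr_ge0].
lra.
Qed.

End error_constants.

Theorem theorem2 (R : realType) (d : nat) (nrm : d.-tuple R -> R)
    (lam : {measure set (d.-tuple R) -> \bar R}) :
  (0 < d)%N -> is_norm nrm -> is_lebesgue lam ->
  forall L gam fm fM D alpha sigma M cK CK : R,
  0 < L -> 0 < gam -> 0 < fm -> 0 < fM -> 0 < D -> 0 < alpha -> 0 < sigma ->
  0 < M -> 0 < cK -> cK <= CK ->
  exists C : R, 0 < C /\
  forall (K : d.-tuple R -> R) (Xset : set (d.-tuple R))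
    (f eta : d.-tuple R -> R)
    (d0 : measure_display) (Omega : measurableType d0) (P : probability Omega R)
    (N : nat) (X : 'I_N -> Omega -> d.-tuple R) (W : 'I_N -> Omega -> R)
    (h T : R) (q : nat),
  (* (K1)-(K3) and radial monotonicity of the kernel *)
  (\int[lam]_u (K u)%:E = 1%:E)%E ->
  (forall u, 1 < nrm u -> K u = 0) ->
  (forall u, nrm u <= 1 -> cK <= K u <= CK) ->
  (forall u v, nrm u <= nrm v -> K v <= K u) ->
  (* the compact set Xset, the density f supported on it, and eta *)
  compact (@row_of_tuple R d @` Xset) ->
  (forall x, 0 <= f x) -> (forall x, ~ Xset x -> f x = 0) ->
  (* (P1) *)
  (forall x1 x2, Xset x1 -> Xset x2 -> `|eta x1 - eta x2| <= L * nrm (tsub x1 x2)) ->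
  (* (P2) *)
  (forall x, Xset x -> fm <= f x <= fM /\ `|eta x| <= M) ->
  (* (P3) *)
  (forall x r, Xset x -> 0 < r -> r < D ->
     ((alpha * vol_unit_ball nrm lam * r ^+ d)%:E <= lam (nball nrm x r `&` Xset))%E) ->
  (* the sample: X_i i.i.d. with density f, W_i independent (and independent
     of the X's), zero mean, finite variance, (P4) *)
  (forall i, measurable_fun setT (X i)) ->
  (forall i, measurable_fun setT (W i)) ->
  mutually_independent P X W ->
  (forall i, has_density P lam (X i) f) ->
  (forall i, P.-integrable setT (fun w => (W i w)%:E) /\
             (\int[P]_w (W i w)%:E = 0)%E) ->
  (forall i, P.-integrable setT (fun w => (W i w ^+ 2)%:E)) ->
  (forall i (lmb : R), `|lmb| <= sigma^-1 ->
     (\int[P]_w (expR (lmb * W i w))%:E <= (expR (sigma ^+ 2 * lmb ^+ 2 / 2))%:E)%E) ->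
  (* parameters: (H1)-(H3) *)
  (2 <= N)%N -> 0 < h -> 0 < T ->
  ln N%:R ^+ 2 / N%:R < h ->
  4 * L * h + 16 * sigma * ln N%:R <= T ->
  (exists m, m < M /\ forall x, Xset x -> `|eta x| <= m) ->
  (* conclusion: the (outer) expectation of sup_A sup_x |hat eta_0 - eta| *)
  exists g : Omega -> \bar R,
    [/\ measurable_fun setT g,
        (forall w, (worst_error q K h T M Xset eta (fun i => X i w) (fun i => W i w)
                    <= g w)%E) &
        (\int[P]_w g w <=
          (C * (T * q%:R / (N%:R * h ^+ d) + h
                + ln N%:R / Num.sqrt (N%:R * h ^+ d)))%:E)%E].
Proof.
move=> d_gt0 nn lamE L gam fm fM D alpha sigma M cK CK L0 gam0 fm0 fM0 D0 alpha0 sigma0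
  M0 cK0 cCK.
pose p0 := fm * alpha * vol_unit_ball nrm lam / 2 ^+ d.
have v0 : 0 < vol_unit_ball nrm lam by have [] := lebesgue_nball nn lamE.
have p00 : 0 < p0 by rewrite divr_gt0 ?exprn_gt0 // !mulr_gt0.
pose l2 : R := ln 2.
have l20 : 0 < l2 by rewrite ln_gt0 // ltr1n.
(* Once [A * lN ^+ 2 <= G], the three summands yield in turn [lN <= g], [1 <= G], and the bound of
   [(d + 3) * lN] by [p0 / 4 * G] required for good samples. *)
pose A := 1 + (l2 ^+ 2)^-1 + 4 * (d + 3)%:R / (p0 * l2).
have A0 : 0 < A by rewrite /A -addrA ltr_pwDl ?ltr01 // addr_ge0 ?invr_ge0 //; nonneg.
pose FB := main_const d L sigma M cK CK p0.
have FB0 : 0 <= FB by exact: main_const_ge0.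
pose fc := failure_const nrm lam fm fM D alpha.
have fc0 : 0 <= fc.
  rewrite /fc /failure_const -/p0.
  have ? := @expR_ge0 R; nonneg.
(* [C1] serves the main case; [C2], [C3] and [C4] serve the trivial cases of large [h], small [G]
   and large [q]. *)
pose C1 := FB + 2 * M * fc / l2 ^+ 2.
pose C2 := 2 * M / D.
pose C3 := 2 * M * Num.sqrt A.
pose C4 := 16 * M / (16 * sigma * l2 * p0).
have C10 : 0 <= C1 by nonneg.
have C20 : 0 <= C2 by nonneg.
have C30 : 0 <= C3 by rewrite /C3; apply: mulr_ge0; [nonneg|exact: sqrtr_ge0].
have C40 : 0 <= C4 by nonneg.
exists (1 + C1 + C2 + C3 + C4); split; first by lra.
move=> K Xset f eta d0 Omega P N X W h T q _ K0 Kc Kmon cX f0 f_out etaL P2 thick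
  mX mW indep Xf _ _ W_mgf N2 h0 T0 hN TT _.
have etaM x : Xset x -> `|eta x| <= M by move=> /P2 [].
have f_in x : Xset x -> fm <= f x <= fM by move=> /P2 [].
have mXset := tuple_of_row_compact_measurable cX.
have N0 : 0 < N%:R :> R by rewrite ltr0n (leq_trans _ N2).
set G := N%:R * h ^+ d; set lN := ln N%:R in hN TT *.
have G0 : 0 < G by rewrite mulr_gt0 ?exprn_gt0.
set g := Num.sqrt G.
have g0 : 0 < g by rewrite sqrtr_gt0.
have gG : G = g ^+ 2 by rewrite sqr_sqrtr // ltW.
have lN2 : l2 <= lN by rewrite ler_ln ?posrE // ler_nat.
have lN0 : 0 < lN by exact: lt_le_trans lN2.
have T0T : 16 * sigma * l2 <= T.
  apply: le_trans TT; apply: (@le_trans _ _ (16 * sigma * lN)).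
    by rewrite ler_pM2l // mulr_gt0.
  by rewrite lerDr; nonneg.
set r := _ + _ + lN / g.
have a10 : 0 <= T * q%:R / G by nonneg.
have a30 : 0 <= lN / g by nonneg.
have r0 : 0 <= r by rewrite /r; lra.
(* In the trivial cases the constant [2 * M] is the measurable majorant, since both the estimate and
   [eta x] are bounded by [M]. *)
have triv c : 0 <= c -> c <= 1 + C1 + C2 + C3 + C4 -> 2 * M <= c * r ->
    exists g : Omega -> \bar R, [/\ measurable_fun setT g,
      forall w, (worst_error q K h T M Xset eta (X^~ w) (W^~ w) <= g w)%E &
      (\int[P]_w g w <= ((1 + C1 + C2 + C3 + C4) * r)%:E)%E].
  move=> c0 cC Mc; exists (cst (2 * M)%:E); split => [|w|].
  - exact: measurable_cst.
  - apply: worst_error_le => x Ys s Sx _ [sM _].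
    by apply: le_trans (ler_normB _ _) _; have := etaM x Sx; lra.
  - rewrite integral_probability_cst lee_fin; apply: le_trans Mc _.
    exact: ler_wpM2r.
have [Dh|hD] := lerP D h.
  apply: (triv C2) => //; first by lra.
  apply: (@le_trans _ _ (C2 * h)); last by apply: ler_wpM2l => //; rewrite /r; lra.
  by rewrite /C2 mulrAC ler_pdivlMr // ler_pM2l // mulr_gt0.
(* For small [G] the term [lN / g] is at least [1 / Num.sqrt A]. *)
have [GA|GA] := ltrP G (A * lN ^+ 2).
  apply: (triv C3) => //; first by lra.
  apply: (@le_trans _ _ (C3 * (lN / g))); last by apply: ler_wpM2l => //; rewrite /r; lra.
  have gA : g <= Num.sqrt A * lN.
    rewrite -[lN]ger0_norm ?(ltW lN0) // -sqrtr_sqr -sqrtrM ?(ltW A0) //.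
    by apply: ler_wsqrtr; exact: ltW.
  by rewrite /C3 mulrA ler_pdivlMr // -!mulrA !ler_pM2l.
(* The threshold is half the guaranteed count in a ball. Above it, [T * q / G] is bounded below
   because [T] is at least [16 * sigma * l2]. *)
have [qn|qn] := ltrP (p0 / 4 * G / 2) q%:R.
  apply: (triv C4) => //; first by lra.
  apply: (@le_trans _ _ (C4 * (T * q%:R / G))); last by apply: ler_wpM2l => //; rewrite /r; lra.
  have sl0 : 0 < 16 * sigma * l2 by rewrite !mulr_gt0.
  have -> : C4 * (T * q%:R / G) = 16 * M * (T * q%:R) / (16 * sigma * l2 * p0 * G).
    by rewrite /C4; field; rewrite !gt_eqF.
  have den0 : 0 < 16 * sigma * l2 * p0 * G by apply: mulr_gt0 => //; exact: mulr_gt0.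
  rewrite ler_pdivlMr //.
  have -> : 2 * M * (16 * sigma * l2 * p0 * G) =
    16 * M * (16 * sigma * l2 * (p0 / 4 * G / 2)) by field.
  apply: ler_wpM2l; first by nonneg.
  by apply: ler_pM => //; [exact: ltW|nonneg|exact: ltW].
have lN22 : l2 ^+ 2 <= lN ^+ 2 by rewrite lerXn2r ?nnegrE // ltW.
have A1 : 1 <= A by rewrite /A -addrA lerDl addr_ge0 ?invr_ge0 //; nonneg.
have G1 : 1 <= G.
  apply: le_trans GA; apply: (@le_trans _ _ ((l2 ^+ 2)^-1 * l2 ^+ 2)).
    by rewrite mulVf // gt_eqF ?exprn_gt0.
  apply: ler_pM => //; rewrite ?invr_ge0; try nonneg.
  by rewrite /A addrAC lerDr; nonneg.
have lNg : lN <= g.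
  rewrite -[lN]ger0_norm ?(ltW lN0) // -sqrtr_sqr; apply: ler_wsqrtr.
  by apply: le_trans GA; rewrite ler_peMl ?exprn_ge0 // ltW.
have zn1 : (d + 3)%:R * lN <= p0 / 4 * G.
  apply: (@le_trans _ _ (p0 / 4 * (4 * (d + 3)%:R / (p0 * l2) * lN ^+ 2))).
    have -> : p0 / 4 * (4 * (d + 3)%:R / (p0 * l2) * lN ^+ 2) =
        (d + 3)%:R * lN * (lN / l2) by field; rewrite !gt_eqF.
    rewrite ler_peMr //; first by nonneg.
    by rewrite ler_pdivlMr // mul1r.
  apply: ler_wpM2l; first by nonneg.
  apply: le_trans GA; apply: ler_wpM2r; first by nonneg.
  by rewrite /A lerDr addr_ge0 ?invr_ge0; nonneg.
have [net [Bad [netP mBad PBad good]]] := good_sample_probability d_gt0 nn lamE mX mW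
  indep Xf f0 fm0 fM0 alpha0 sigma0 mXset f_out f_in thick W_mgf N2 h0 hD G1 zn1.
(* A measurable majorant of the worst error: [2 * M] covers the exceptional event, and the main rate
   covers its complement. *)
pose bound w : \bar R := (2 * M * \1_Bad w + FB * r)%:E.
exists bound; split.
- apply/measurable_EFinP; apply: measurable_funD => //; apply: measurable_funM => //.
- move=> w; apply: worst_error_le => x Ys s Sx Yatt S.
  have [wB|wB] := pselect (Bad w).
    rewrite indicE mem_set // mulr1; have [sM _] := S.
    apply: le_trans (ler_normB _ _) _; have := etaM x Sx.
    by have := mulr_ge0 FB0 r0; lra.
  rewrite indicE memNset // mulr0 add0r.
  have w0 : 0 <= 8 * sigma * lN by nonneg.
  apply: le_trans (good_sample_error nn N2 h0 netP (good w wB) w0 K0 Kc Kmon etaL etaM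
    L0 T0 cK0 cCK _ _ _ _ Sx Yatt S) _.
  + by nonneg.
  + by rewrite -/lN; have := TT; have := mulr_gt0 L0 h0; lra.
  + by rewrite mulr_gt0 // divr_gt0.
  + exact: qn.
  + by apply: main_const_bound => //; exact: ltW.
- rewrite integral_indicD_cst //; [|nonneg|exact: mulr_ge0].
  apply: (@le_trans _ _ ((2 * M)%:E * (fc / N%:R)%:E + (FB * r)%:E)%E).
    by apply: leeD => //; apply: lee_wpmul2l => //; rewrite lee_fin; nonneg.
  rewrite -EFinM -EFinD lee_fin; apply: (@le_trans _ _ (C1 * r)); last first.
    by apply: ler_wpM2r => //; lra.
  have -> : C1 * r = 2 * M * fc / l2 ^+ 2 * r + FB * r by rewrite [C1]addrC mulrDl.
  rewrite lerD2r.
  (* The exceptional event costs a multiple of [1 / N], which (H1) turns into a multiple of [h], as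
     [l2 ^ 2 / N <= lN ^ 2 / N < h]. *)
  have -> : 2 * M * (fc / N%:R) = 2 * M * fc / l2 ^+ 2 * (l2 ^+ 2 / N%:R).
    by field; rewrite !gt_eqF.
  apply: ler_wpM2l; first by nonneg.
  apply: (@le_trans _ _ h); last by rewrite /r; lra.
  apply: ltW; apply: le_lt_trans hN; rewrite ler_pM2r ?invr_gt0 //.
Qed.
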